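(* Let $p$ be a prime and let $k$ be a field of characteristic $p$. The following hold, with all isomorphisms being of $k$-algebras. (a) Let $f(x)=\sum_{i=1}^{p-1}(-1)^{i-1}(p-i)^{-1}x^i$. The algebra B2 $=k\langle x,y,z\rangle/\langle [x,y]-y,\,[x,z],\,[y,z]-yf(x),\,x^p-x,\,y^p,\,z^p-z\rangle$ is isomorphic to $k\widetilde{\mathbb{A}}_{p^2-1}/J^p$, and it is not a symmetric algebra. (b) The algebra C12 $=k\langle x,y,z\rangle/\langle [x,y]-y,[x,z],[y,z],x^p-x,y^p-z,z^p\rangle$ is isomorphic to $k\widetilde{\mathbb{A}}_{p-1}/J^{p^2}$. (c) The algebra C13 $=k\langle x,y,z\rangle/\langle [x,y]-y,[x,z],[y,z],x^p-x,y^p,z^p-z\rangle$ is isomorphic to a direct sum of $p$ copies of the selfinjective Nakayama algebra $k\widetilde{\mathbb{A}}_{p-1}/J^p$, which has dimension $p^2$. (d) The algebra C14 $=k\langle x,y,z\rangle/\langle [x,y]-y,[x,z],[y,z],x^p-x,y^p-z,z^p-z\rangle$ is isomorphic to the direct sum of $k\widetilde{\mathbb{A}}_{p-1}/J^p$ and $p-1$ copies of the matrix algebra $M_p(k)$.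
   Context: $k\langle x,y,z\rangle$ is the free associative algebra and $[a,b]=ab-ba$. $\widetilde{\mathbb{A}}_n$ denotes the quiver with $n+1$ vertices and exactly one arrow starting in each vertex, the arrows forming a single oriented cycle through all the vertices. $k\widetilde{\mathbb{A}}_n$ is its path algebra and $J$ is the ideal of $k\widetilde{\mathbb{A}}_n$ generated by the arrows. A finite dimensional $k$-algebra $\Lambda$ is symmetric if $\Lambda\simeq \operatorname{Hom}_k(\Lambda,k)$ as $\Lambda$-$\Lambda$-bimodules. *)

(* Defs.v *)
From HB Require Import structures.
From mathcomp Require Import all_boot all_algebra.
From mathcomp Require Import boolp classical_sets.
From mathcomp Require Import finmap.
From mathcomp.multinomials Require Import monalg.

Set Implicit Arguments.
Unset Strict Implicit.
Unset Printing Implicit Defensive.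

Import GRing.Theory.
Local Open Scope classical_set_scope.
Local Open Scope quotient_scope.
Local Open Scope ring_scope.

(* Ideals are two-sided and not required to be proper. A quotient algebra may   *)
(* thus be zero, which algType excludes: it gets a pzRingType structure and an  *)
(* lmodType structure instead.                                                  *)

Record is_ideal (R : pzRingType) (I : set R) : Prop := IsIdeal {
  ideal0 : I 0;
  idealB : forall a b, I a -> I b -> I (a - b);
  idealMl : forall a b, I b -> I (a * b);
  idealMr : forall a b, I a -> I (a * b) }.

Record ideal (R : pzRingType) :=
  Ideal { ideal_set :> R -> Prop; idealP : is_ideal ideal_set }.

Lemma smallest_is_ideal (R : pzRingType) (S : set R) :
  is_ideal (smallest (@is_ideal R) S).
Proof.
split=> [I [idI _]|a b Ia Ib I SI|a b Ib I SI|a b Ia I SI].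
- exact: ideal0.
- by apply: (idealB SI.1); [exact: Ia|exact: Ib].
- by apply: (idealMl SI.1); exact: Ib.
- by apply: (idealMr SI.1); exact: Ia.
Qed.

Definition ideal_gen (R : pzRingType) (S : set R) : ideal R :=
  Ideal (smallest_is_ideal S).

Definition ideal_mul (R : pzRingType) (I K : ideal R) : ideal R :=
  ideal_gen [set x | exists a b, [/\ I a, K b & x = a * b]].

Fixpoint ideal_exp (R : pzRingType) (I : ideal R) (m : nat) : ideal R :=
  if m is m'.+1 then ideal_mul I (ideal_exp I m') else ideal_gen setT.

Section Quotient.
Variables (k : fieldType) (A : lalgType k) (I : ideal A).

Definition ideal_pred : {pred A} := fun a => `[< I a >].

Fact ideal_pred_zmod_closed : zmod_closed ideal_pred.
Proof.
split=> [|a b]; first exact/asboolP/(ideal0 (idealP I)).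
by move=> /asboolP Ia /asboolP Ib; apply/asboolP/(idealB (idealP I)).
Qed.

HB.instance Definition _ :=
  GRing.isZmodClosed.Build A ideal_pred ideal_pred_zmod_closed.

Definition quotAlg : Type := Quotient.quot ideal_pred.

HB.instance Definition _ := GRing.Zmodule.on quotAlg.

Definition quot_pi (a : A) : quotAlg := \pi_(Quotient.quot ideal_pred) a.
Definition quot_repr (u : quotAlg) : A :=
  repr (u : Quotient.quot ideal_pred).

Definition quot_mul (u v : quotAlg) := quot_pi (quot_repr u * quot_repr v).
Definition quot_scale (c : k) (u : quotAlg) := quot_pi (c *: quot_repr u).

Lemma quot_reprK : cancel quot_repr quot_pi.
Proof. by move=> u; exact: reprK. Qed.

Lemma quot_piP a b : quot_pi a = quot_pi b <-> I (a - b).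
Proof.
split=> [/eqP|Iab].
  by rewrite /quot_pi -Quotient.idealrBE => /asboolP.
by apply/eqP; rewrite /quot_pi -Quotient.idealrBE; apply/asboolP.
Qed.

Lemma quot_piK a : I (quot_repr (quot_pi a) - a).
Proof. by apply/quot_piP; rewrite quot_reprK. Qed.

Lemma quot_piD a b : quot_pi (a + b) = quot_pi a + quot_pi b.
Proof. by rewrite /quot_pi raddfD. Qed.

Lemma quot_piM a b : quot_pi (a * b) = quot_mul (quot_pi a) (quot_pi b).
Proof.
apply/esym/quot_piP; set a' := quot_repr _; set b' := quot_repr _.
have -> : a' * b' - a * b = (a' - a) * b' - (- a * (b' - b)).
  by rewrite mulrBl mulNr opprK mulrBr addrA subrK.
apply: (idealB (idealP I)).
  exact/(idealMr (idealP I))/quot_piK.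
exact/(idealMl (idealP I))/quot_piK.
Qed.

Lemma quot_piZ c a : quot_pi (c *: a) = quot_scale c (quot_pi a).
Proof.
apply/esym/quot_piP; rewrite -scalerBr -mulr_algl.
exact/(idealMl (idealP I))/quot_piK.
Qed.

Fact quot_mulA : associative quot_mul.
Proof.
move=> u v w; rewrite -[u]quot_reprK -[v]quot_reprK -[w]quot_reprK.
by rewrite -!quot_piM mulrA.
Qed.

Fact quot_mul1 : left_id (quot_pi 1) quot_mul.
Proof. by move=> u; rewrite -[u]quot_reprK -quot_piM mul1r. Qed.

Fact quot_1mul : right_id (quot_pi 1) quot_mul.
Proof. by move=> u; rewrite -[u]quot_reprK -quot_piM mulr1. Qed.

Fact quot_mulDl : left_distributive quot_mul +%R.
Proof.
move=> u v w; rewrite -[u]quot_reprK -[v]quot_reprK -[w]quot_reprK.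
by rewrite -quot_piD -!quot_piM -quot_piD mulrDl.
Qed.

Fact quot_mulDr : right_distributive quot_mul +%R.
Proof.
move=> u v w; rewrite -[u]quot_reprK -[v]quot_reprK -[w]quot_reprK.
by rewrite -quot_piD -!quot_piM -quot_piD mulrDr.
Qed.

HB.instance Definition _ := GRing.Zmodule_isPzRing.Build quotAlg
  quot_mulA quot_mul1 quot_1mul quot_mulDl quot_mulDr.

Fact quot_scaleA a b u :
  quot_scale a (quot_scale b u) = quot_scale (a * b) u.
Proof. by rewrite -[u]quot_reprK -!quot_piZ scalerA. Qed.

Fact quot_scale1 : left_id 1 quot_scale.
Proof. by move=> u; rewrite -[u]quot_reprK -quot_piZ scale1r. Qed.

Fact quot_scaleDr : right_distributive quot_scale +%R.
Proof.
move=> a u v; rewrite -[u]quot_reprK -[v]quot_reprK.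
by rewrite -quot_piD -!quot_piZ -quot_piD scalerDr.
Qed.

Fact quot_scaleDl u : {morph quot_scale^~ u : a b / a + b}.
Proof.
by move=> a b; rewrite -[u]quot_reprK -!quot_piZ -quot_piD scalerDl.
Qed.

HB.instance Definition _ := GRing.Zmodule_isLmodule.Build k quotAlg
  quot_scaleA quot_scale1 quot_scaleDr quot_scaleDl.

End Quotient.

Notation "{ 'quotAlg' A / I }" := (@quotAlg _ A I)
  (at level 0, A at level 2, format "{ 'quotAlg'  A  /  I }").

(* A notation rather than a definition, so that the ring and the k-module      *)
(* structures of A and B are inferred separately.                              *)
Notation "A ≃alg B" :=
  (exists phi : {rmorphism A -> B}, scalable phi /\ bijective phi)
  (at level 70, no associativity).

(* Phi is an isomorphism of L-L-bimodules from L to Hom_k(L, k), where mul is   *)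
(* the multiplication of L and (a f b)(x) = f (b x a). Finite dimension is not  *)
(* part of the definition; such a Phi forces it.                                *)
Definition symmetric_alg (k : fieldType) (L : lmodType k)
    (mul : L -> L -> L) : Prop :=
  exists Phi : L -> {linear L -> k^o},
    [/\ forall (c : k) a b x, Phi (c *: a + b) x = c * Phi a x + Phi b x,
        forall a l b x, Phi (mul (mul a l) b) x = Phi l (mul (mul b x) a),
        forall l l', Phi l =1 Phi l' -> l = l'
      & forall f : {linear L -> k^o}, exists l, Phi l =1 f].

Section Modules.
Variable R : pzRingType.

Definition injective_module (E : lmodType R) : Prop :=
  forall (M N : lmodType R) (i : {linear M -> N}) (f : {linear M -> E}),
    injective i -> exists g : {linear N -> E}, forall m, g (i m) = f m.

Definition projective_module (P : lmodType R) : Prop :=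
  forall (M N : lmodType R) (q : {linear M -> N}) (f : {linear P -> N}),
    (forall n, exists m, q m = n) ->
    exists g : {linear P -> M}, forall x, q (g x) = f x.

Definition is_submodule (M : lmodType R) (U : set M) : Prop :=
  U 0 /\ forall a u v, U u -> U v -> U (a *: u + v).

Definition uniserial (M : lmodType R) : Prop :=
  forall U V : set M,
    is_submodule U -> is_submodule V -> U `<=` V \/ V `<=` U.

Definition indecomposable (M : lmodType R) : Prop :=
  (exists m : M, m <> 0) /\
  forall U V : set M, is_submodule U -> is_submodule V ->
    (forall m, exists u v, [/\ U u, V v & m = u + v]) ->
    U `&` V = [set 0] -> U = [set 0] \/ V = [set 0].

Definition left_serial : Prop :=
  forall P : lmodType R,
    projective_module P -> indecomposable P -> uniserial P.

End Modules.

(* Right R-modules are left modules over the converse ring R^c.                *)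
Definition selfinjective (R : pzRingType) : Prop :=
  injective_module (R^o : lmodType R) /\
  injective_module (R^c^o : lmodType R^c).

Definition nakayama (R : pzRingType) : Prop :=
  left_serial R /\ left_serial R^c.

(* Vertices are 0, ..., n: a quiver without vertices would have a zero path     *)
(* algebra.                                                                     *)
Record quiver (n : nat) := Quiver {
  arrow : finType;
  source : arrow -> 'I_n.+1;
  target : arrow -> 'I_n.+1 }.

Section Paths.
Variables (n : nat) (Q : quiver n).

Fixpoint walk (v : 'I_n.+1) (s : seq (arrow Q)) : bool :=
  if s is a :: s' then (source a == v) && walk (target a) s' else true.

(* A path is given by its starting vertex and its arrows in order of           *)
(* traversal; (v, [::]) is the trivial path e_v. In the path algebra, p * q is  *)
(* p followed by q.                                                             *)
Record qpath := QPath {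
  path_val : 'I_n.+1 * seq (arrow Q);
  _ : walk path_val.1 path_val.2 }.

HB.instance Definition _ := [isSub for path_val].
HB.instance Definition _ := [Choice of qpath by <:].

Definition path_end (p : qpath) : 'I_n.+1 :=
  last (val p).1 [seq target a | a <- (val p).2].

Definition path_cat (p q : qpath) : option qpath :=
  if path_end p == (val q).1
  then insub ((val p).1, (val p).2 ++ (val q).2) else None.

Definition path_triv (v : 'I_n.+1) : qpath := @QPath (v, [::]) isT.

Fact walk_arrow (a : arrow Q) : walk (source a) [:: a].
Proof. by rewrite /= eqxx. Qed.

Definition path_arrow (a : arrow Q) : qpath :=
  @QPath (source a, [:: a]) (walk_arrow a).

End Paths.

Lemma bilinear_assoc (k : fieldType) (V : lmodType k) (T : Type) (e : T -> V)
    (m : V -> V -> V) :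
    (forall P : V -> Prop, P 0 -> (forall f g, P f -> P g -> P (f + g)) ->
      (forall c f, P f -> P (c *: f)) -> (forall t, P (e t)) ->
      forall f, P f) ->
    left_distributive m +%R -> right_distributive m +%R ->
    (forall c f g, m (c *: f) g = c *: m f g) ->
    (forall c f g, m f (c *: g) = c *: m f g) ->
    (forall t u v, m (e t) (m (e u) (e v)) = m (m (e t) (e u)) (e v)) ->
  associative m.
Proof.
move=> ind D1 D2 Z1 Z2 mA.
have O1 f : m 0 f = 0 by rewrite -(scale0r 0) Z1 !scale0r.
have O2 f : m f 0 = 0 by rewrite -(scale0r 0) Z2 !scale0r.
move=> f g h; elim/ind: f => [|f f' IH IH'|c f IH|t].
- by rewrite !O1.
- by rewrite !D1 IH IH'.
- by rewrite !Z1 IH.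
elim/ind: g => [|g g' IH IH'|c g IH|u].
- by rewrite O1 O2 O1.
- by rewrite D1 !D2 D1 IH IH'.
- by rewrite Z1 !Z2 Z1 IH.
elim/ind: h => [|h h' IH IH'|c h IH|v].
- by rewrite !O2.
- by rewrite !D2 IH IH'.
- by rewrite !Z2 IH.
exact: mA.
Qed.

Section PathAlgebra.
Variables (k : fieldType) (n : nat) (Q : quiver n).
Local Notation path := (qpath Q).
Implicit Types p q r : path.

Definition pathAlg : Type := {malg k[path]}.

HB.instance Definition _ := GRing.Lmodule.on pathAlg.

Definition path_elt (p : path) : pathAlg := locked << p >>.

Definition path_mul2 (p q : path) : pathAlg := oapp path_elt 0 (path_cat p q).

Definition path_mul (f g : pathAlg) : pathAlg :=
  \sum_(p <- msupp f) \sum_(q <- msupp g) (f@_p * g@_q) *: path_mul2 p q.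

Definition path_one : pathAlg := \sum_v path_elt (path_triv Q v).

Lemma path_eltE p q : (path_elt p)@_q = (p == q)%:R.
Proof. by rewrite /path_elt -lock mcoeffU. Qed.

Lemma path_mulw (d1 d2 : {fset path}) f g :
  (msupp f `<=` d1)%fset -> (msupp g `<=` d2)%fset ->
  path_mul f g =
    \sum_(p <- d1) \sum_(q <- d2) (f@_p * g@_q) *: path_mul2 p q.
Proof.
move=> le1 le2; rewrite /path_mul (big_fset_incl _ le1) /=.
  apply/eq_bigr=> p _; apply/big_fset_incl => // q _ /mcoeff_outdom ->.
  by rewrite mulr0 scale0r.
move=> p _ /mcoeff_outdom fp.
by rewrite big1 // => q _; rewrite fp mul0r scale0r.
Qed.

Fact path_mulDl : left_distributive path_mul +%R.
Proof.
move=> f g h; pose d := (msupp f `|` msupp g `|` msupp (f + g)%R)%fset.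
rewrite !(@path_mulw d (msupp h)) ?fsubset_refl //.
- rewrite -big_split; apply/eq_bigr=> p _; rewrite -big_split.
  by apply/eq_bigr=> q _; rewrite mcoeffD mulrDl scalerDl.
- by rewrite /d -fsetUA fsetUCA fsubsetUl.
- by rewrite /d -fsetUA fsubsetUl.
- by rewrite /d fsubsetUr.
Qed.

Fact path_mulDr : right_distributive path_mul +%R.
Proof.
move=> h f g; pose d := (msupp f `|` msupp g `|` msupp (f + g)%R)%fset.
rewrite !(@path_mulw (msupp h) d) ?fsubset_refl //.
- rewrite -big_split; apply/eq_bigr=> p _; rewrite -big_split.
  by apply/eq_bigr=> q _; rewrite mcoeffD mulrDr scalerDl.
- by rewrite /d -fsetUA fsetUCA fsubsetUl.
- by rewrite /d -fsetUA fsubsetUl.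
- by rewrite /d fsubsetUr.
Qed.

Fact path_scaleAl c f g : c *: path_mul f g = path_mul (c *: f) g.
Proof.
rewrite (@path_mulw (msupp f) (msupp g) (c *: f)) ?msuppZ_le //.
rewrite scaler_sumr; apply/eq_bigr=> p _.
rewrite scaler_sumr; apply/eq_bigr=> q _.
by rewrite scalerA mcoeffZ mulrA.
Qed.

Fact path_scaleAr c f g : c *: path_mul f g = path_mul f (c *: g).
Proof.
rewrite (@path_mulw (msupp f) (msupp g) f (c *: g)) ?msuppZ_le //.
rewrite scaler_sumr; apply/eq_bigr=> p _.
rewrite scaler_sumr; apply/eq_bigr=> q _.
by rewrite scalerA mcoeffZ mulrCA.
Qed.

Lemma path_mul0l f : path_mul 0 f = 0.
Proof. by rewrite /path_mul msupp0 big_seq_fset0. Qed.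

Lemma path_mul0r f : path_mul f 0 = 0.
Proof. by rewrite /path_mul big1 // => p _; rewrite msupp0 big_seq_fset0. Qed.

Lemma path_mul_suml (J : Type) (s : seq J) (F : J -> pathAlg) g :
  path_mul (\sum_(j <- s) F j) g = \sum_(j <- s) path_mul (F j) g.
Proof.
by apply: (big_morph (path_mul^~ g)) => [a b|]; [exact: path_mulDl|exact: path_mul0l].
Qed.

Lemma path_mul_sumr (J : Type) (s : seq J) (F : J -> pathAlg) g :
  path_mul g (\sum_(j <- s) F j) = \sum_(j <- s) path_mul g (F j).
Proof.
by apply: (big_morph (path_mul g)) => [a b|]; [exact: path_mulDr|exact: path_mul0r].
Qed.

Lemma path_mulUU p q : path_mul (path_elt p) (path_elt q) = path_mul2 p q.
Proof.
have le r : (msupp (path_elt r) `<=` [fset r])%fset.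
  by rewrite /path_elt -lock msuppU_le.
rewrite (path_mulw (le p) (le q)) !big_seq_fset1 !path_eltE !eqxx.
by rewrite mulr1 scale1r.
Qed.

Lemma pathAlgE (f : pathAlg) :
  f = \sum_(p <- msupp f) f@_p *: path_elt p.
Proof.
rewrite {1}[f]monalgE; apply/eq_bigr=> p _; apply/malgP=> q.
by rewrite [RHS]mcoeffZ [LHS]mcoeffU path_eltE mulr_natr.
Qed.

Lemma walk_cat v (s t : seq (arrow Q)) :
  walk v (s ++ t) = walk v s && walk (last v [seq target a | a <- s]) t.
Proof. by elim: s v => //= a s IH v; rewrite IH andbA. Qed.

Lemma path_catP (p q r : path) : path_cat p q = Some r <->
  path_end p = (val q).1 /\ val r = ((val p).1, (val p).2 ++ (val q).2).
Proof.
rewrite /path_cat; case: eqP => [pq|pq]; last by split=> // -[].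
case: insubP => [r' _ vr'|]; first split=> [[<-]//|[_ vr]].
  by congr Some; apply/val_inj; rewrite vr.
by rewrite /= walk_cat (valP p) -/(path_end p) pq (valP q).
Qed.

Lemma path_cat_defined (p q : path) :
  path_end p = (val q).1 -> exists r, path_cat p q = Some r.
Proof.
move=> pq; have w : walk (val p).1 ((val p).2 ++ (val q).2).
  by rewrite walk_cat (valP p) -/(path_end p) pq (valP q).
by exists (@QPath _ Q ((val p).1, (val p).2 ++ (val q).2) w); apply/path_catP.
Qed.

Lemma path_catN (p q : path) : path_cat p q = None <-> path_end p <> (val q).1.
Proof.
split=> [pqN /path_cat_defined[r]|]; first by rewrite pqN.
by rewrite /path_cat; case: eqP.
Qed.

Lemma path_end_cat (p q r : path) : path_cat p q = Some r -> path_end r = path_end q.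
Proof.
move=> /path_catP[pq vr]; rewrite /path_end vr /= map_cat last_cat.
by rewrite -/(path_end p) pq.
Qed.

Lemma path_start_cat (p q r : path) : path_cat p q = Some r -> (val r).1 = (val p).1.
Proof. by move=> /path_catP[_ ->]. Qed.

Lemma path_catA (p q r : path) :
  obind (path_cat p) (path_cat q r) = obind (fun s => path_cat s r) (path_cat p q).
Proof.
case qr: (path_cat q r) => [s|] /=; case pq: (path_cat p q) => [t|] //=.
- have [/path_catP[pqe vt] /path_catP[qre vs]] := (pq, qr).
  have [u pu] : exists u, path_cat p s = Some u.
    by apply: path_cat_defined; rewrite (path_start_cat qr).
  rewrite pu; apply/esym/path_catP; rewrite (path_end_cat pq); split=> //.
  by move/path_catP: pu => [_ ->]; rewrite vs vt /= catA.
- by apply/path_catN; rewrite (path_start_cat qr); apply/path_catN.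
- by apply/esym/path_catN; rewrite (path_end_cat pq); apply/path_catN.
Qed.

Lemma path_mul2A p q r :
  path_mul (path_elt p) (path_mul2 q r) = path_mul (path_mul2 p q) (path_elt r).
Proof.
rewrite [path_mul2 q r]/path_mul2 [path_mul2 p q]/path_mul2.
case: (path_cat q r) (path_cat p q) (path_catA p q r) => [s|] [t|] /= E.
- by rewrite [LHS]path_mulUU [RHS]path_mulUU /path_mul2 E.
- by rewrite [LHS]path_mulUU [RHS]path_mul0l /path_mul2 E.
- by rewrite [LHS]path_mul0r [RHS]path_mulUU /path_mul2 -E.
- by rewrite [LHS]path_mul0r [RHS]path_mul0l.
Qed.

Lemma pathAlg_ind (P : pathAlg -> Prop) :
    P 0 -> (forall f g, P f -> P g -> P (f + g)) ->
    (forall c f, P f -> P (c *: f)) -> (forall p, P (path_elt p)) ->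
  forall f, P f.
Proof.
move=> P0 PD PZ PU f; rewrite (pathAlgE f).
by elim/big_ind: _ => // p _; apply/PZ/PU.
Qed.

Fact path_mulA : associative path_mul.
Proof.
apply: (@bilinear_assoc k pathAlg _ path_elt).
- exact: pathAlg_ind.
- exact: path_mulDl.
- exact: path_mulDr.
- by move=> *; exact/esym/path_scaleAl.
- by move=> *; exact/esym/path_scaleAr.
- move=> p q r; transitivity (path_mul (path_elt p) (path_mul2 q r)).
    by congr path_mul; exact: path_mulUU.
  transitivity (path_mul (path_mul2 p q) (path_elt r)); first exact: path_mul2A.
  by congr path_mul; exact/esym/path_mulUU.
Qed.

Lemma path_mul2_1l p : path_mul path_one (path_elt p) = path_elt p.
Proof.
rewrite /path_one path_mul_suml (bigD1 (val p).1) //=.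
rewrite [X in X + _]path_mulUU big1 => [|v nv].
  rewrite addr0 /path_mul2.
  have /path_catP -> // : path_end (path_triv Q (val p).1) = (val p).1 /\
    val p = ((val (path_triv Q (val p).1)).1,
             (val (path_triv Q (val p).1)).2 ++ (val p).2).
  by split=> //=; case: (path_val p).
rewrite [LHS]path_mulUU /path_mul2.
have /path_catN -> // : path_end (path_triv Q v) <> (val p).1.
exact/eqP.
Qed.

Lemma path_mul2_1r p : path_mul (path_elt p) path_one = path_elt p.
Proof.
rewrite /path_one path_mul_sumr (bigD1 (path_end p)) //=.
rewrite [X in X + _]path_mulUU big1 => [|v nv].
  rewrite addr0 /path_mul2.
  have /path_catP -> // : path_end p = (val (path_triv Q (path_end p))).1 /\
    val p = ((val p).1, (val p).2 ++ (val (path_triv Q (path_end p))).2).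
  by split=> //=; rewrite cats0; case: (path_val p).
rewrite [LHS]path_mulUU /path_mul2.
have /path_catN -> // : path_end p <> (val (path_triv Q v)).1.
by apply/eqP; rewrite eq_sym.
Qed.

Fact path_mul1 : left_id path_one path_mul.
Proof.
move=> f; elim/pathAlg_ind: f => [|f f' IH IH'|c f IH|p].
- exact: path_mul0r.
- by rewrite [LHS]path_mulDr IH IH'.
- transitivity (c *: path_mul path_one f); first exact/esym/path_scaleAr.
  by rewrite IH.
- exact: path_mul2_1l.
Qed.

Fact path_1mul : right_id path_one path_mul.
Proof.
move=> f; elim/pathAlg_ind: f => [|f f' IH IH'|c f IH|p].
- exact: path_mul0l.
- by rewrite [LHS]path_mulDl IH IH'.
- transitivity (c *: path_mul f path_one); first exact/esym/path_scaleAl.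
  by rewrite IH.
- exact: path_mul2_1r.
Qed.

Fact path_one_neq0 : path_one != 0.
Proof.
pose e := path_triv Q ord0; apply/eqP=> z.
have : \sum_v (path_elt (path_triv Q v))@_e = 0.
  transitivity (mcoeff e path_one); first exact/esym/raddf_sum.
  by rewrite z; exact: mcoeff0.
under eq_bigr => v _ do rewrite path_eltE.
rewrite (bigD1 ord0) // -/e eqxx big1 => [/eqP|v nv].
  by rewrite /= addr0 oner_eq0.
by case: eqP => // /(congr1 val) [ve]; rewrite ve eqxx in nv.
Qed.

HB.instance Definition _ := GRing.Zmodule_isNzRing.Build pathAlg
  path_mulA path_mul1 path_1mul path_mulDl path_mulDr path_one_neq0.
HB.instance Definition _ := GRing.Lmodule_isLalgebra.Build k pathAlg
  path_scaleAl.
HB.instance Definition _ := GRing.Lalgebra_isAlgebra.Build k pathAlg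
  path_scaleAr.

Definition arrow_ideal : ideal pathAlg :=
  ideal_gen (range (fun a => path_elt (path_arrow a))).

End PathAlgebra.

(* The quiver with an arrow i -> i + 1 mod n + 1 for each vertex i.            *)
Definition cyclic_quiver (n : nat) : quiver n :=
  @Quiver n 'I_n.+1 id (@ordS n.+1).

Definition cyclic_trunc (k : fieldType) (n m : nat) : Type :=
  {quotAlg (pathAlg k (cyclic_quiver n)) /
    ideal_exp (arrow_ideal k (cyclic_quiver n)) m}.

HB.instance Definition _ k n m := GRing.PzRing.on (cyclic_trunc k n m).
HB.instance Definition _ k n m := GRing.Lmodule.on (cyclic_trunc k n m).

Notation freeAlg k := {malg k[{fmonom 'I_3}]}.

Definition lie (R : pzRingType) (a b : R) : R := a * b - b * a.

Section Algebras.
Variables (k : fieldType) (p : nat).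

Let x : freeAlg k := << fmu (@Ordinal 3 0 isT) >>.
Let y : freeAlg k := << fmu (@Ordinal 3 1 isT) >>.
Let z : freeAlg k := << fmu (@Ordinal 3 2 isT) >>.

Definition polyf : freeAlg k :=
  \sum_(1 <= i < p) ((-1) ^+ (i - 1) * (p - i)%:R^-1) *: x ^+ i.

Definition relsB2 : seq (freeAlg k) :=
  [:: lie x y - y; lie x z; lie y z - y * polyf;
      x ^+ p - x; y ^+ p; z ^+ p - z].

Definition relsC12 : seq (freeAlg k) :=
  [:: lie x y - y; lie x z; lie y z; x ^+ p - x; y ^+ p - z; z ^+ p].

Definition relsC13 : seq (freeAlg k) :=
  [:: lie x y - y; lie x z; lie y z; x ^+ p - x; y ^+ p; z ^+ p - z].

Definition relsC14 : seq (freeAlg k) :=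
  [:: lie x y - y; lie x z; lie y z; x ^+ p - x; y ^+ p - z; z ^+ p - z].

Definition algB2 : Type := {quotAlg (freeAlg k) / ideal_gen [set` relsB2]}.
Definition algC12 : Type := {quotAlg (freeAlg k) / ideal_gen [set` relsC12]}.
Definition algC13 : Type := {quotAlg (freeAlg k) / ideal_gen [set` relsC13]}.
Definition algC14 : Type := {quotAlg (freeAlg k) / ideal_gen [set` relsC14]}.

HB.instance Definition _ := GRing.PzRing.on algB2.
HB.instance Definition _ := GRing.Lmodule.on algB2.
HB.instance Definition _ := GRing.PzRing.on algC12.
HB.instance Definition _ := GRing.Lmodule.on algC12.
HB.instance Definition _ := GRing.PzRing.on algC13.
HB.instance Definition _ := GRing.Lmodule.on algC13.
HB.instance Definition _ := GRing.PzRing.on algC14.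
HB.instance Definition _ := GRing.Lmodule.on algC14.

End Algebras.

(* Main.v *)
Require Import Defs.
From HB Require Import structures.
From mathcomp Require Import all_boot all_algebra.
From mathcomp Require Import boolp classical_sets.
From mathcomp Require Import finmap.
From mathcomp.multinomials Require Import monalg.

Set Implicit Arguments.
Unset Strict Implicit.
Unset Printing Implicit Defensive.

Import GRing.Theory.
Local Open Scope ring_scope.

(* An element x with x^p = x splits into idempotents E_c(x), c in F_p, where   *)
(* E_c(X) = 1 - (X - c)^(p-1) is the Lagrange polynomial at c. The relation    *)
(* [x, y] = y makes y send the c-eigenspace of x to the (c+1)-eigenspace, so   *)
(* the E_c(x) are the vertices and y the sum of the arrows of a cyclic quiver; *)
(* universal properties give homomorphisms both ways, which are inverse on     *)
(* generators. In C13 and C14 the central element z is split first; where it   *)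
(* takes a value c != 0 in C14, (y / c)^p = 1 and the block is M_p(k).         *)
(* In B2 the vertices are the joint eigenvalues (i, j) of x and z, and y acts  *)
(* by (i, j) |-> (i + 1, j - f(i)). This is a single cycle of length p^2       *)
(* because the sum of f over F_p is minus its coefficient of degree p - 1,     *)
(* hence nonzero. A symmetrizing form on B2 would vanish on the ideal spanned  *)
(* by the e_v y^(p-1), as these paths are not closed.                          *)
(* Summing the coefficients of the longest paths gives a Frobenius form, and   *)
(* extending linear functionals (Zorn) gives injectivity. A nonzero projective *)
(* P has y^(m-1) P != 0 (by a dual basis), so it contains some R e_v, which    *)
(* splits off; its submodules are the y^i R e_v.                               *)

(** All the algebras are compared through one notion: orthogonal idempotents e_v, with v in Z/(n+1),
    and an element y such that e_v y = y e_(v+1) and e_v y^m = kap e_v. When the e_v sum to 1 and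
    the e_v y^l with l < m form a basis ([cyc_basis]), the multiplication table is forced, so any
    other system with the same n, m and kap, in any algebra, receives a multiplicative linear map
    [psi]. The truncated path algebra is the case kap = 0 ([trunc_basis]). The matrix algebra is the
    case kap = 1, m = n + 1 ([mat_basis]).

    A presented algebra A maps to such a target T by its universal property, and [psi] leads back
    once a system is found in A; [iso_of_system] concludes for B2 and C12. Since [psi] need not
    preserve 1, it can also embed a single block: for C13 and C14 the maps of the p blocks are added
    up by [glue]. For B2, every p steps along the cycle return the eigenvalue of x and change that
    of z by the nonzero constant [bsum k p], so the p^2 vertices carry distinct pairs of eigenvalues
    ([ab_inj]).

    A symmetric algebra has a nondegenerate trace form ([symmetric_trace]), which
    [trace_form_degenerate] excludes when no longest path is closed. For a truncated cyclic algebra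
    R, the Frobenius form [frob] translates R-linear maps into R to k-linear functionals, so partial
    R-linear maps extend ([linear_extension]). This gives injectivity of R, and it also splits a
    copy of R e_v off a projective module. Each nonzero element of R e_v generates the same
    submodule as some y^i e_v ([right_ideal_gen]), whence uniseriality. Right modules are covered by
    [conv_basis]: the opposite algebra has a basis of the same kind. *)

(** * Presented algebras *)

(* A possibly zero k-algebra: MathComp's algType only covers nonzero ones. *)
Record salg (k : fieldType) := SAlg {
  salg_ring :> pzRingType;
  sc : {rmorphism k -> salg_ring};
  scC : forall c a, sc c * a = a * sc c }.

Section SAlgTheory.
Variables (k : fieldType) (A : salg k).
Implicit Types (a b : A) (c d : k).

Lemma mulr_sc a c b : a * (sc A c * b) = sc A c * (a * b).
Proof. by rewrite !mulrA -scC. Qed.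

Definition conv_sc : k -> A^c := sc A.
Fact conv_sc_zmod : zmod_morphism conv_sc.
Proof. exact: (raddfB (sc A)). Qed.
Fact conv_sc_mon : monoid_morphism conv_sc.
Proof.
split; first exact: (rmorph1 (sc A)).
by move=> c d; rewrite mulrC; exact: (rmorphM (sc A)).
Qed.
HB.instance Definition _ := GRing.isZmodMorphism.Build k A^c conv_sc conv_sc_zmod.
HB.instance Definition _ := GRing.isMonoidMorphism.Build k A^c conv_sc conv_sc_mon.
Fact conv_scC c (a : A^c) : conv_sc c * a = a * conv_sc c.
Proof. exact/esym/(scC (s := A)). Qed.
Definition conv_salg : salg k := SAlg conv_scC.

Section LinearExtension.
Variables (K : choiceType) (h : K -> A).
Implicit Types f g : {malg k[K]}.

Definition lin f : A := \sum_(m <- msupp f) sc A f@_m * h m.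

Lemma linw (d : {fset K}) f : (msupp f `<=` d)%fset ->
  lin f = \sum_(m <- d) sc A f@_m * h m.
Proof.
move=> le; rewrite /lin (big_fset_incl _ le) //= => m _ /mcoeff_outdom ->.
by rewrite rmorph0 mul0r.
Qed.

Lemma linB f g : lin (f - g) = lin f - lin g.
Proof.
pose d := (msupp f `|` msupp g `|` msupp (f - g)%R)%fset.
rewrite !(@linw d).
- rewrite -sumrB; apply: eq_bigr => m _.
  by rewrite mcoeffB rmorphB mulrBl.
- by rewrite /d -fsetUA fsetUCA fsubsetUl.
- by rewrite /d -fsetUA fsubsetUl.
- by rewrite /d fsubsetUr.
Qed.

HB.instance Definition _ := GRing.isZmodMorphism.Build {malg k[K]} A lin linB.

Lemma linZ c f : lin (c *: f) = sc A c * lin f.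
Proof.
rewrite (@linw (msupp f)) ?msuppZ_le // mulr_sumr; apply: eq_bigr => m _.
by rewrite mcoeffZ rmorphM mulrA.
Qed.

Lemma linU m : lin << m >> = h m.
Proof.
by rewrite (linw (d := [fset m]%fset)) ?msuppU_le // big_seq_fset1 mcoeffUU
  rmorph1 mul1r.
Qed.
End LinearExtension.
End SAlgTheory.

Lemma malg_ind (k : fieldType) (K : choiceType) (P : {malg k[K]} -> Prop) :
  P 0 -> (forall f g, P f -> P g -> P (f + g)) ->
  (forall c f, P f -> P (c *: f)) -> (forall m, P << m >>) -> forall f, P f.
Proof.
move=> P0 PD PZ PU f; rewrite [f]monalgE; elim/big_ind: _ => // m _.
have -> : << f@_m *g m >> = f@_m *: << m >> :> {malg k[K]}.
  by apply/malgP => q; rewrite mcoeffZ !mcoeffU mulr_natr.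
exact/PZ/PU.
Qed.

Section QuotientAlgebra.
Variables (k : fieldType) (A : lalgType k) (I : ideal A).
Hypothesis AZr : forall (c : k) (a b : A), c *: (a * b) = a * (c *: b).
Local Notation Q := {quotAlg A / I}.
Local Notation pi := (quot_pi I : A -> Q).

Lemma quot_piB a b : pi (a - b) = pi a - pi b.
Proof. by rewrite /quot_pi raddfB. Qed.
Lemma quot_pi_mon : monoid_morphism pi.
Proof. by split=> // a b; rewrite quot_piM. Qed.
HB.instance Definition _ := GRing.isZmodMorphism.Build A Q (quot_pi I) quot_piB.
HB.instance Definition _ := GRing.isMonoidMorphism.Build A Q (quot_pi I) quot_pi_mon.

Lemma quot_ind (P : Q -> Prop) : (forall a, P (pi a)) -> forall u, P u.
Proof. by move=> Ppi u; rewrite -[u]quot_reprK. Qed.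

Lemma quot_pi_scale c a : pi (c *: a) = c *: pi a.
Proof. exact: quot_piZ. Qed.

Lemma quot_pi_eq0 a : I a -> pi a = 0.
Proof. by move=> Ia; rewrite -(rmorph0 pi); apply/quot_piP; rewrite subr0. Qed.

Definition quot_sc (c : k) : Q := c *: (1 : Q).
Lemma quot_scE c : quot_sc c = pi (c *: 1).
Proof. by rewrite quot_pi_scale rmorph1. Qed.
Fact quot_sc_zmod : zmod_morphism quot_sc.
Proof. by move=> c d; rewrite /quot_sc scalerBl. Qed.
Fact quot_sc_mon : monoid_morphism quot_sc.
Proof.
split=> [|c d]; first by rewrite /quot_sc scale1r.
by rewrite !quot_scE -rmorphM mulr_algl scalerA.
Qed.
HB.instance Definition _ := GRing.isZmodMorphism.Build k Q quot_sc quot_sc_zmod.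
HB.instance Definition _ := GRing.isMonoidMorphism.Build k Q quot_sc quot_sc_mon.
Lemma quot_sc_scale c (u : Q) : quot_sc c * u = c *: u.
Proof.
by elim/quot_ind: u => a; rewrite quot_scE -rmorphM mulr_algl /= quot_pi_scale.
Qed.
Fact quot_scC c (u : Q) : quot_sc c * u = u * quot_sc c.
Proof.
elim/quot_ind: u => a; rewrite quot_scE -!rmorphM mulr_algl.
by rewrite -AZr mulr1.
Qed.
Definition quot_salg : salg k := SAlg quot_scC.

Lemma quot_lift (B : pzRingType) (f : {rmorphism A -> B}) :
  (forall a, I a -> f a = 0) ->
  exists g : {rmorphism Q -> B}, forall a, g (pi a) = f a.
Proof.
move=> fI; pose g (u : Q) := f (quot_repr u).
have gE a : g (pi a) = f a.
  by apply/eqP; rewrite -subr_eq0 -rmorphB fI //; exact: quot_piK.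
have gB : zmod_morphism g.
  move=> u v; elim/quot_ind: u => a; elim/quot_ind: v => b.
  by rewrite -rmorphB !gE rmorphB.
have gM : monoid_morphism g.
  split=> [|u v]; first by rewrite -(rmorph1 pi) gE rmorph1.
  elim/quot_ind: u => a; elim/quot_ind: v => b.
  by rewrite -rmorphM !gE rmorphM.
pose mB := GRing.isZmodMorphism.Build Q B g gB.
pose mM := GRing.isMonoidMorphism.Build Q B g gM.
pose G : {rmorphism Q -> B} := HB.pack g mB mM.
by exists G.
Qed.
End QuotientAlgebra.

Lemma ideal_gen_sub (R : pzRingType) (S : set R) a : S a -> ideal_gen S a.
Proof. by move=> Sa K [_]; exact. Qed.

Lemma ideal_gen_min (R : pzRingType) (S K : set R) :
  is_ideal K -> (forall a, S a -> K a) -> forall a, ideal_gen S a -> K a.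
Proof. by move=> idK SK a; apply. Qed.

Lemma rmorph_ker_ideal (R S : pzRingType) (f : {rmorphism R -> S}) :
  is_ideal (fun a => f a = 0).
Proof.
split=> [|a b fa fb|a b fb|a b fa]; first exact: rmorph0.
- by rewrite rmorphB fa fb subrr.
- by rewrite rmorphM fb mulr0.
- by rewrite rmorphM fa mul0r.
Qed.

Section MonoidAlgebra.
Variables (k : fieldType) (K : monomType).
Local Notation F := {malg k[K]}.

Lemma malg_scaleAr (c : k) (a b : F) : c *: (a * b) = a * (c *: b).
Proof.
apply/malgP => m; rewrite mcoeffZ (mcoeffMlw _ (fsubset_refl _) (msuppZ_le c b)).
rewrite mcoeffMl mulr_sumr; apply: eq_bigr => u _.
rewrite mulr_sumr; apply: eq_bigr => v _.
by rewrite mcoeffZ mulrnAr mulrCA.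
Qed.

Lemma malgUM (m m' : K) : << m >> * << m' >> = << mmul m m' >> :> F.
Proof. by rewrite malgME !msuppU1 !big_seq_fset1 !mcoeffUU mulr1. Qed.

Variables (B : salg k) (h : K -> B).
Hypotheses (h1 : h mone = 1) (hM : forall m m', h (mmul m m') = h m * h m').

Lemma lin_mon : monoid_morphism (lin h).
Proof.
split=> [|f g]; first by rewrite linU h1.
elim/malg_ind: f g => [|f f' IH IH'|c f IH|m] g.
- by rewrite mul0r !raddf0 mul0r.
- by rewrite mulrDl !raddfD /= mulrDl IH IH'.
- by rewrite -scalerAl !linZ IH mulrA.
elim/malg_ind: g => [|g g' IH IH'|c g IH|m'].
- by rewrite mulr0 !raddf0 mulr0.
- by rewrite mulrDr !raddfD /= mulrDr IH IH'.
- by rewrite -malg_scaleAr !linZ IH mulr_sc.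
by rewrite malgUM !linU hM.
Qed.
End MonoidAlgebra.

Section FreeAlgebra.
Variable k : fieldType.
Local Notation F := (freeAlg k).
Variables (B : salg k) (b : 'I_3 -> B).
Definition word_eval (m : {fmonom 'I_3}) : B := \prod_(i <- (m : seq _)) b i.
Definition free_eval : F -> B := lin word_eval.

Lemma free_evalU i : free_eval << fmu i >> = b i.
Proof. by rewrite /free_eval linU /word_eval fmU big_seq1. Qed.

Lemma free_evalZ c a : free_eval (c *: a) = sc B c * free_eval a.
Proof. exact: linZ. Qed.

Fact free_eval_zmod : zmod_morphism free_eval.
Proof. exact: linB. Qed.
HB.instance Definition _ := GRing.isZmodMorphism.Build F B free_eval free_eval_zmod.

Fact free_eval_mon : monoid_morphism free_eval.
Proof.
apply: lin_mon => [|m m'].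
  by rewrite /word_eval fm1 big_nil.
by rewrite /word_eval fmM big_cat.
Qed.
HB.instance Definition _ := GRing.isMonoidMorphism.Build F B free_eval free_eval_mon.

Lemma free_ind (P : F -> Prop) : P 1 -> (forall a c, P a -> P (c *: a)) ->
  (forall a b, P a -> P b -> P (a + b)) ->
  (forall i a, P a -> P (<< fmu i >> * a)) -> forall a, P a.
Proof.
move=> P1 PZ PD PX a; elim/malg_ind: a => //.
- by rewrite -(scale0r 1); apply: PZ.
- by move=> c f; apply: PZ.
move=> m; have [s ->] : exists s, m = FMonom s by case: m => s; exists s.
elim: s => [|i s IH].
  by rewrite -fmoneE.
have -> : FMonom (i :: s) = mmul (fmu i) (FMonom s) :> {fmonom 'I_3}.
  by rewrite /mmul /= fmmulE fmU.
by rewrite -malgUM; exact: PX.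
Qed.
End FreeAlgebra.

Section Presentation.
Variables (k : fieldType) (rels : seq (freeAlg k)).
Local Notation I := (ideal_gen [set` rels]).
Local Notation Q := {quotAlg (freeAlg k) / I}.

Definition pres : salg k := quot_salg I (@malg_scaleAr k _).
Definition gen i : pres := quot_pi I << fmu i >>.

Lemma gen_eval a : quot_pi I a = free_eval gen a :> pres.
Proof.
elim/free_ind: a => [|a c IH|a b IHa IHb|i a IH].
- by rewrite !rmorph1.
- by rewrite free_evalZ quot_pi_scale -quot_sc_scale IH.
- by rewrite !rmorphD /= IHa IHb.
- by rewrite !rmorphM /= free_evalU IH.
Qed.

Lemma pres_rel r : r \in rels -> free_eval gen r = 0.
Proof.
by move=> rr; rewrite -gen_eval; apply: quot_pi_eq0; exact: ideal_gen_sub.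
Qed.

Lemma pres_lift (B : salg k) (b : 'I_3 -> B) :
  (forall r, r \in rels -> free_eval b r = 0) ->
  exists f : {rmorphism pres -> B},
    (forall c, f (sc pres c) = sc B c) /\ (forall i, f (gen i) = b i).
Proof.
move=> br; have [|f fE] := @quot_lift _ _ I B (free_eval b).
  by apply: ideal_gen_min; [exact: rmorph_ker_ideal|].
exists f; split=> [c|i]; last by rewrite fE /= free_evalU.
by rewrite [sc pres c]quot_scE fE /= free_evalZ rmorph1 mulr1.
Qed.

Lemma pres_ext (f : pres -> pres) : f 1 = 1 -> (forall a b, f (a + b) = f a + f b) ->
  (forall a b, f (a * b) = f a * f b) ->
  (forall c a, f (sc pres c * a) = sc pres c * f a) ->
  (forall i, f (gen i) = gen i) -> forall a, f a = a.
Proof.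
move=> f1 fD fM fZ fg u; elim/quot_ind: u => a.
elim/free_ind: a => [|a c IH|a b IHa IHb|i a IH].
- by rewrite rmorph1.
- by rewrite quot_pi_scale -quot_sc_scale fZ IH.
- by rewrite rmorphD /= fD IHa IHb.
- by rewrite rmorphM /= fM IH fg.
Qed.
End Presentation.

(** * Bases of paths in a cyclic system of idempotents *)

Local Notation shift := (fun l => iter l (@ordS _)).

Lemma val_shift n l (v : 'I_n.+1) : shift l v = ((v + l) %% n.+1)%N :> nat.
Proof.
elim: l => [|l IH] /=; first by rewrite addn0 modn_small.
by rewrite IH -addn1 modnDml addn1 addnS.
Qed.

Section CyclicSystem.
Variables (k : fieldType) (n m : nat) (kap : k).

(* Multiplication by y moves the support of the idempotent e v to e (v + 1),   *)
(* and y^m acts as the scalar kap: kap = 0 for the truncated cyclic quiver,     *)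
(* kap = 1 and m = n + 1 for matrices.                                          *)
Record cyc_sys (A : salg k) (e : 'I_n.+1 -> A) (y : A) : Prop := CycSys {
  cs_orth : forall v w, e v * e w = if v == w then e v else 0;
  cs_shift : forall v, e v * y = y * e (ordS v);
  cs_pow : forall v, e v * y ^+ m = sc A kap * e v }.

(** The coordinate functionals are carried as data, so that linear maps out of A can be written by a
    formula. [cb_dual] and [cb_span] only involve lengths l < m. *)
Record cyc_basis (A : salg k) (e : 'I_n.+1 -> A) (y : A)
    (c : 'I_n.+1 -> nat -> A -> k) : Prop := CycBasis {
  cb_sys : cyc_sys e y;
  cb_sum : \sum_v e v = 1;
  cb_coefD : forall v l a b, c v l (a + b) = c v l a + c v l b;
  cb_coefZ : forall v l d a, c v l (sc A d * a) = d * c v l a;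
  cb_dual : forall v l w j, (l < m)%N -> (j < m)%N ->
    c v l (e w * y ^+ j) = ((v == w) && (l == j))%:R;
  cb_span : forall a,
    a = \sum_v \sum_(l < m) sc A (c v l a) * (e v * y ^+ l) }.

Section Sys.
Variables (A : salg k) (e : 'I_n.+1 -> A) (y : A).
Hypothesis S : cyc_sys e y.

Lemma sys_shift l v : e v * y ^+ l = y ^+ l * e (shift l v).
Proof.
elim: l v => [|l IH] v; first by rewrite !expr0 mulr1 mul1r.
by rewrite exprSr mulrA IH -mulrA (cs_shift S) mulrA.
Qed.

Lemma sys_mul v l w j : (e v * y ^+ l) * (e w * y ^+ j) =
  if shift l v == w then e v * y ^+ (l + j) else 0.
Proof.
rewrite sys_shift mulrA -[y ^+ l * _ * _]mulrA (cs_orth S).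
case: eqP => [_|_]; last by rewrite mulr0 mul0r.
by rewrite -sys_shift exprD mulrA.
Qed.

(** Euclidean division of the exponent by m: each factor y^m acts as kap. For kap = 0 the scalar is
    1 if j < m and 0 otherwise. *)
Lemma sys_mod v j :
  e v * y ^+ j = sc A (kap ^+ (j %/ m)) * (e v * y ^+ (j %% m)).
Proof.
rewrite {1}(divn_eq j m) exprD mulrA mulnC exprM mulrA; congr (_ * _).
elim: (j %/ m)%N => [|q IH]; first by rewrite !expr0 rmorph1 mul1r mulr1.
by rewrite !exprSr mulrA IH -mulrA (cs_pow S) rmorphM mulrA.
Qed.
End Sys.

(** The spanning hypothesis is an induction principle without a bound on the exponent; [sys_mod]
    brings each e_v y^l below m and yields the expansion in coordinates. *)
Lemma cyc_basis_of_ind (A : salg k) (e : 'I_n.+1 -> A) (y : A)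
    (c : 'I_n.+1 -> nat -> A -> k) : (0 < m)%N ->
    cyc_sys e y -> \sum_v e v = 1 ->
    (forall v l a b, c v l (a + b) = c v l a + c v l b) ->
    (forall v l d a, c v l (sc A d * a) = d * c v l a) ->
    (forall v l w j, (l < m)%N -> (j < m)%N ->
      c v l (e w * y ^+ j) = ((v == w) && (l == j))%:R) ->
    (forall P : A -> Prop, (forall a b, P a -> P b -> P (a + b)) ->
      (forall d a, P a -> P (sc A d * a)) -> (forall v l, P (e v * y ^+ l)) ->
      forall a, P a) ->
  cyc_basis e y c.
Proof.
move=> m_gt0 S e1 cD cZ cdual ind; split=> //.
apply: ind => [a b IHa IHb|d a IH|v j].
- rewrite {1}IHa {1}IHb -big_split /=; apply: eq_bigr => v _.
  rewrite -big_split /=; apply: eq_bigr => l _.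
  by rewrite cD rmorphD mulrDl.
- rewrite {1}IH mulr_sumr; apply: eq_bigr => v _; rewrite mulr_sumr.
  by apply: eq_bigr => l _; rewrite cZ rmorphM -mulrA.
have lt : (j %% m < m)%N by rewrite ltn_mod.
rewrite (sys_mod S) (bigD1 v) //= (bigD1 (Ordinal lt)) //=.
rewrite cZ cdual // !eqxx mulr1 !big1 ?addr0 //.
- move=> w /negPf nv; rewrite big1 // => l _.
  by rewrite cZ cdual // nv mulr0 rmorph0 mul0r.
- move=> l /negPf nl; rewrite cZ cdual // eqxx /=.
  by move: nl; rewrite -val_eqE /= => ->; rewrite mulr0 rmorph0 mul0r.
Qed.

Section Basis.
Variables (A : salg k) (e : 'I_n.+1 -> A) (y : A) (c : 'I_n.+1 -> nat -> A -> k).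
Hypothesis bas : cyc_basis e y c.
Let S := cb_sys bas.

Lemma basis_ind (P : A -> Prop) : (forall a b, P a -> P b -> P (a + b)) ->
  (forall d a, P a -> P (sc A d * a)) -> (forall v l, P (e v * y ^+ l)) ->
  forall a, P a.
Proof.
move=> PD PZ PE a; rewrite (cb_span bas a).
have P0 : P 0 by rewrite -(mul0r (e ord0 * y ^+ 0)) -(rmorph0 (sc A)); exact: PZ.
elim/big_ind: _ => // v _; elim/big_ind: _ => // l _.
exact: PZ.
Qed.

Lemma cb_coef0 v l : c v l 0 = 0.
Proof. by rewrite -(mul0r 0) -[X in X * _](rmorph0 (sc A)) (cb_coefZ bas) mul0r. Qed.

Lemma cb_coef_sum v l (J : Type) (s : seq J) (P : pred J) (F : J -> A) :
  c v l (\sum_(j <- s | P j) F j) = \sum_(j <- s | P j) c v l (F j).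
Proof. exact: (big_morph (c v l) (cb_coefD bas v l) (cb_coef0 v l)). Qed.

Lemma cb_coef_inj a b : (forall v l, (l < m)%N -> c v l a = c v l b) -> a = b.
Proof.
move=> ab; rewrite (cb_span bas a) (cb_span bas b).
by apply: eq_bigr => v _; apply: eq_bigr => l _; rewrite ab.
Qed.

Hypothesis m_gt0 : (0 < m)%N.
Variables (B : salg k) (e' : 'I_n.+1 -> B) (y' : B).
Hypothesis S' : cyc_sys e' y'.

(** The linear map that sends e_v y^l to e'_v y'^l. The e'_v are not asked to sum to 1, so B may be
    larger than the image. *)
Definition psi a : B := \sum_v \sum_(l < m) sc B (c v l a) * (e' v * y' ^+ l).

Lemma psiD a b : psi (a + b) = psi a + psi b.
Proof.
rewrite /psi -big_split /=; apply: eq_bigr => v _; rewrite -big_split /=.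
by apply: eq_bigr => l _; rewrite (cb_coefD bas) rmorphD mulrDl.
Qed.

Lemma psiZ d a : psi (sc A d * a) = sc B d * psi a.
Proof.
rewrite /psi mulr_sumr; apply: eq_bigr => v _; rewrite mulr_sumr.
by apply: eq_bigr => l _; rewrite (cb_coefZ bas) rmorphM -mulrA.
Qed.

Lemma psi0 : psi 0 = 0.
Proof. by rewrite -(mul0r 0) -[X in X * _](rmorph0 (sc A)) psiZ rmorph0 mul0r. Qed.

Lemma psi_sum (J : Type) (s : seq J) (P : pred J) (F : J -> A) :
  psi (\sum_(j <- s | P j) F j) = \sum_(j <- s | P j) psi (F j).
Proof. exact: (big_morph psi psiD psi0). Qed.

Lemma psiE v j : psi (e v * y ^+ j) = e' v * y' ^+ j.
Proof.
rewrite (sys_mod S) (sys_mod S') psiZ; congr (_ * _).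
have lt : (j %% m < m)%N by rewrite ltn_mod.
rewrite /psi (bigD1 v) //= (bigD1 (Ordinal lt)) //=.
rewrite (cb_dual bas) // !eqxx rmorph1 mul1r !big1 ?addr0 //.
- move=> w /negPf nv; rewrite big1 // => l _.
  by rewrite (cb_dual bas) // nv rmorph0 mul0r.
- move=> l /negPf nl; rewrite (cb_dual bas) // eqxx /=.
  by move: nl; rewrite -val_eqE /= => ->; rewrite rmorph0 mul0r.
Qed.

(** By bilinearity it suffices to multiply basis elements, and [sys_mul] gives the same rule in A
    and in B. *)
Lemma psiM a b : psi (a * b) = psi a * psi b.
Proof.
elim/basis_ind: a b => [a a' IH IH'|d a IH|v l] b.
- by rewrite mulrDl !psiD mulrDl IH IH'.
- by rewrite -mulrA !psiZ IH mulrA.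
elim/basis_ind: b => [b b' IH IH'|d b IH|w j].
- by rewrite mulrDr !psiD mulrDr IH IH'.
- by rewrite mulr_sc !psiZ IH mulr_sc.
rewrite (sys_mul S) !psiE (sys_mul S').
by case: eqP; rewrite ?psiE ?psi0.
Qed.

Lemma psi_e v : psi (e v) = e' v.
Proof. by move: (psiE v 0); rewrite !expr0 !mulr1. Qed.

Lemma psi1 : psi 1 = \sum_v e' v.
Proof. by rewrite -(cb_sum bas) psi_sum; apply: eq_bigr => v _; exact: psi_e. Qed.

Lemma psi_y : psi y = (\sum_v e' v) * y'.
Proof.
rewrite -[y in LHS]mul1r -(cb_sum bas) !mulr_suml psi_sum.
by apply: eq_bigr => v _; move: (psiE v 1); rewrite !expr1.
Qed.
End Basis.
End CyclicSystem.

(** * The truncated path algebra and the matrix algebra *)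

Section TruncatedCyclicAlgebra.
Variables (k : fieldType) (n m : nat).
Local Notation Q := (cyclic_quiver n).
Local Notation P := (pathAlg k Q).
Local Notation J := (arrow_ideal k Q).
Implicit Types (v w : 'I_n.+1) (l j : nat).

Fact cpath_walk v l : @walk n Q v (traject (@ordS n.+1) v l).
Proof. by elim: l v => //= l IH v; rewrite eqxx IH. Qed.

(** An arrow is named by its source, and each vertex emits exactly one, so a path is determined by
    its start and its length ([qpathE]). *)
Definition cpath v l : qpath Q :=
  @QPath n Q (v, traject (@ordS n.+1) v l) (cpath_walk v l).

Lemma qpathE (p : qpath Q) : p = cpath (val p).1 (size (val p).2).
Proof.
apply: val_inj; case: p => -[v s] /= w; congr (_, _).
elim: s v w => //= a s IH v /andP[/eqP <- ws]; congr (_ :: _).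
exact: IH.
Qed.

Lemma cpath_eq v l w j : (cpath v l == cpath w j) = (v == w) && (l == j).
Proof.
apply/eqP/andP => [|[/eqP-> /eqP->]//] /(congr1 val) [-> E]; split=> //.
by rewrite -(size_traject (@ordS n.+1) w l) E size_traject.
Qed.

Lemma cpath_end v l : path_end (cpath v l) = shift l v.
Proof.
by rewrite /path_end /=; elim: l v => //= l IH v; rewrite IH -iterSr.
Qed.

Lemma cpath_mul v l w j : path_mul (path_elt k (cpath v l)) (path_elt k (cpath w j)) =
  if shift l v == w then path_elt k (cpath v (l + j)) else 0.
Proof.
rewrite path_mulUU /path_mul2; case: eqP => [E|E]; last first.
  by have /path_catN -> // : path_end (cpath v l) <> (val (cpath w j)).1
    by rewrite cpath_end.
have /path_catP -> // : path_end (cpath v l) = (val (cpath w j)).1 /\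
  val (cpath v (l + j)) =
  ((val (cpath v l)).1, (val (cpath v l)).2 ++ (val (cpath w j)).2).
by rewrite cpath_end E; split=> //=; rewrite trajectD E.
Qed.

Let E v : P := path_elt k (cpath v 0).
Let Y : P := \sum_v path_elt k (cpath v 1).

(** Multiplication by the sum Y of all arrows extends a path in the only possible way. *)
Lemma cpath_pow v l : path_elt k (cpath v l) = E v * Y ^+ l.
Proof.
elim: l => [|l IH]; first by rewrite expr0 mulr1.
rewrite exprSr mulrA -IH mulr_sumr (bigD1 (shift l v)) //= big1 => [|w nw].
  by rewrite [X in _ = X + _]cpath_mul eqxx addr0 addn1.
by rewrite [LHS]cpath_mul eq_sym (negPf nw).
Qed.

(** The span of the paths of length at least i. It contains J^i ([ideal_exp_low]), while J^i
    contains the paths of length i ([ideal_exp_cpath]); this is what is needed to compute modulo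
    J^m. *)
Definition low (i : nat) (f : P) := forall v l, (l < i)%N -> f@_(cpath v l) = 0.

Lemma low_mul i j (f g : P) : low i f -> low j g -> low (i + j) (f * g).
Proof.
move=> fi gj v l li; rewrite [f * g]/(path_mul f g) /path_mul.
rewrite [LHS](raddf_sum (mcoeff (cpath v l))) big1 // => p _.
rewrite [LHS](raddf_sum (mcoeff (cpath v l))) big1 // => q _.
rewrite (qpathE p) (qpathE q); move: (val p).1 (size (val p).2) (val q).1 (size (val q).2).
move=> w a w' b; rewrite [LHS]mcoeffZ.
have [ai|ai] := ltnP a i; first by rewrite fi // !mul0r.
have [bj|bj] := ltnP b j; first by rewrite gj // mulr0 mul0r.
rewrite -[path_mul2 _ _ _]path_mulUU cpath_mul.
case: eqP => _; last by rewrite mcoeff0 mulr0.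
rewrite path_eltE cpath_eq [_ == l]gtn_eqF ?andbF ?mulr0 //.
exact: leq_trans li (leq_add ai bj).
Qed.

Lemma low_ideal i : is_ideal (low i).
Proof.
have low0 (f : P) : low 0 f by [].
split=> [v l _|f g fi gi v l li|f g gi|f g fi]; first exact: mcoeff0.
- by rewrite [LHS]mcoeffB fi // gi // subrr.
- exact: (low_mul (low0 f) gi).
- by rewrite -(addn0 i); exact: low_mul.
Qed.

Lemma ideal_exp_low i f : ideal_exp J i f -> low i f.
Proof.
elim: i f => [f _ v l //|i IH f].
apply: ideal_gen_min; first exact: low_ideal.
move=> _ [a [b [Ja Jb ->]]]; rewrite -add1n; apply: low_mul; last exact: IH.
apply: ideal_gen_min Ja; first exact: low_ideal.
move=> _ [u _ <-] v [|//] _; rewrite path_eltE.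
by rewrite (qpathE (path_arrow _)) cpath_eq andbF.
Qed.

Lemma ideal_exp_cpath i v : ideal_exp J i (path_elt k (cpath v i)).
Proof.
elim: i v => [|i IH] v; first exact: ideal_gen_sub.
apply: ideal_gen_sub; exists (path_elt k (cpath v 1)).
exists (path_elt k (cpath (ordS v) i)); split; [|exact: IH|].
  apply: ideal_gen_sub; exists v; first by [].
  by congr (path_elt k); apply: val_inj.
by apply/esym; rewrite [LHS]cpath_mul eqxx.
Qed.

Local Notation I := (ideal_exp J m).

Definition trunc_salg : salg k := quot_salg I (@scalerAr k P).
Local Notation pi := (quot_pi I).
Definition trunc_e v : trunc_salg := pi (E v).
Definition trunc_y : trunc_salg := pi Y.
(** Read off a chosen representative; for l < m the choice is harmless, because elements of J^m have
    no coefficient on paths shorter than m. *)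
Definition trunc_coef v l (a : trunc_salg) : k :=
  if (l < m)%N then (quot_repr a)@_(cpath v l) else 0.

Lemma trunc_coef_pi v l f : (l < m)%N -> trunc_coef v l (pi f) = f@_(cpath v l).
Proof.
move=> lm; rewrite /trunc_coef lm; apply/eqP; rewrite -subr_eq0.
by rewrite -[X in X == 0]mcoeffB (ideal_exp_low (quot_piK I f)).
Qed.

Let piM (f g : P) : pi f * pi g = pi (f * g) :> trunc_salg.
Proof. exact/esym/quot_piM. Qed.

Lemma trunc_pow v l : trunc_e v * trunc_y ^+ l = pi (path_elt k (cpath v l)).
Proof.
rewrite cpath_pow -piM; congr (_ * _).
by elim: l => // l IH; rewrite !exprS IH piM.
Qed.

Lemma trunc_coef_dual v l w j : (l < m)%N ->
  trunc_coef v l (trunc_e w * trunc_y ^+ j) = ((v == w) && (l == j))%:R.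
Proof.
by move=> lm; rewrite trunc_pow trunc_coef_pi // path_eltE cpath_eq
  [w == v]eq_sym [j == l]eq_sym.
Qed.

Lemma trunc_basis : (0 < m)%N -> cyc_basis m 0 trunc_e trunc_y trunc_coef.
Proof.
have cD v l (a b : trunc_salg) :
    trunc_coef v l (a + b) = trunc_coef v l a + trunc_coef v l b.
  have [lm|lm] := ltnP l m; last by rewrite /trunc_coef ltnNge lm addr0.
  elim/quot_ind: a => a; elim/quot_ind: b => b.
  by rewrite -raddfD !trunc_coef_pi // [LHS]mcoeffD.
have cZ v l d (a : trunc_salg) :
    trunc_coef v l (sc trunc_salg d * a) = d * trunc_coef v l a.
  have [lm|lm] := ltnP l m; last by rewrite /trunc_coef ltnNge lm mulr0.
  elim/quot_ind: a => a.
  by rewrite [_ * _]quot_sc_scale -quot_pi_scale !trunc_coef_pi // [LHS]mcoeffZ.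
have powm v : trunc_e v * trunc_y ^+ m = 0.
  by rewrite trunc_pow; apply/quot_pi_eq0/ideal_exp_cpath.
move=> m_gt0; apply: cyc_basis_of_ind; [exact: m_gt0| | |exact: cD|exact: cZ| |].
- split=> [v w|v|v].
  + have EE : E v * E w = if v == w then E v else 0 by exact: cpath_mul.
    rewrite /trunc_e piM EE; case: eqP => // _.
    exact: rmorph0.
  + have YE : E v * Y = Y * E (ordS v).
      rewrite -[X in _ * X = _]expr1 -cpath_pow mulr_suml (bigD1 v) //=.
      rewrite big1 => [|w nw].
        by rewrite [X in _ = X + _]cpath_mul eqxx addr0.
      rewrite [LHS]cpath_mul; case: eqP => // /(congr1 (@ord_pred _)).
      by rewrite /= !ordSK => wv; rewrite wv eqxx in nw.
    transitivity (pi (E v * Y) : trunc_salg); first exact: piM.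
    rewrite YE; exact/esym/piM.
  + by rewrite powm rmorph0 mul0r.
- have E1 : \sum_v E v = path_one k Q.
    by apply: eq_bigr => v _; congr (path_elt k); apply: val_inj.
  have pi0 : pi 0 = 0 by exact: rmorph0.
  transitivity (pi (\sum_v E v) : trunc_salg).
    exact/esym/(big_morph _ (quot_piD I) pi0).
  by rewrite E1.
- by move=> v l w j lm _; exact: trunc_coef_dual.
move=> H HD HZ HE a; elim/quot_ind: a; elim/pathAlg_ind => [|f g Hf Hg|d f Hf|p].
- have -> : pi 0 = sc trunc_salg 0 * (trunc_e ord0 * trunc_y ^+ 0).
    by rewrite rmorph0 mul0r; exact: rmorph0.
  exact/HZ/HE.
- have -> : pi (f + g) = pi f + pi g :> trunc_salg by exact: quot_piD.
  exact: HD.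
- have -> : pi (d *: f) = sc trunc_salg d * pi f :> trunc_salg.
    by rewrite [RHS]quot_sc_scale; exact: quot_piZ.
  exact: HZ.
by rewrite (qpathE p) -trunc_pow.
Qed.

Lemma trunc_scale c (a : trunc_salg) : sc trunc_salg c * a = c *: (a : cyclic_trunc k n m).
Proof. exact: quot_sc_scale. Qed.
End TruncatedCyclicAlgebra.

Section MatrixBasis.
Variables (k : fieldType) (n : nat).

Definition mat_sc : k -> 'M[k]_n.+1 := scalar_mx.
Fact mat_sc_zmod : zmod_morphism mat_sc.
Proof. exact: (raddfB (@scalar_mx k n.+1)). Qed.
Fact mat_sc_mon : monoid_morphism mat_sc.
Proof. by split=> // c d; exact: (rmorphM (@scalar_mx k n.+1)). Qed.
HB.instance Definition _ :=
  GRing.isZmodMorphism.Build k 'M[k]_n.+1 mat_sc mat_sc_zmod.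
HB.instance Definition _ :=
  GRing.isMonoidMorphism.Build k 'M[k]_n.+1 mat_sc mat_sc_mon.
Fact mat_scC c (M : 'M[k]_n.+1) : mat_sc c * M = M * mat_sc c.
Proof.
by rewrite -[LHS]/(c%:M *m M) -[RHS]/(M *m c%:M) mul_scalar_mx mul_mx_scalar.
Qed.
Definition mat_salg : salg k := SAlg mat_scC.

Definition mat_e v : mat_salg := delta_mx v v.
(** The cyclic permutation matrix; e_v y^l is then the matrix unit in row v and column v + l modulo
    n + 1. *)
Definition mat_y : mat_salg := \sum_v delta_mx v (ordS v).
Definition mat_coef (v : 'I_n.+1) (l : nat) (M : mat_salg) : k :=
  (M : 'M_n.+1) v (shift l v).

Lemma mat_pow v l : mat_e v * mat_y ^+ l = delta_mx v (shift l v) :> 'M[k]_n.+1.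
Proof.
elim: l => [|l IH]; first by rewrite expr0 mulr1.
rewrite exprSr mulrA IH mulr_sumr (bigD1 (shift l v)) //= big1 => [|w nw].
  by rewrite addr0 -[_ * _]/(_ *m _) mul_delta_mx.
by rewrite -[_ * _]/(_ *m _) mul_delta_mx_0 // eq_sym.
Qed.

Lemma shift_inj l j (v : 'I_n.+1) : (l < n.+1)%N -> (j < n.+1)%N ->
  shift l v = shift j v -> l = j.
Proof.
move=> ln jn /(congr1 val); rewrite /= !val_shift => /eqP.
by rewrite eqn_modDl !modn_small // => /eqP.
Qed.

Lemma shift_full (v : 'I_n.+1) : shift n.+1 v = v.
Proof. by apply: val_inj; rewrite [LHS]val_shift modnDr modn_small. Qed.

Lemma mat_basis : cyc_basis n.+1 1 mat_e mat_y mat_coef.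
Proof.
have sys : cyc_sys n.+1 1 mat_e mat_y.
  split=> [v w|v|v].
  - rewrite /mat_e; case: eqP => [<-|/eqP vw]; first exact: mul_delta_mx.
    exact: mul_delta_mx_0.
  - move: (mat_pow v 1); rewrite expr1 => ->.
    rewrite /mat_y mulr_suml (bigD1 v) //= big1 => [|w nw].
      by rewrite addr0; apply/esym/mul_delta_mx.
    rewrite -[_ * _]/(_ *m _) mul_delta_mx_0 //.
    apply: contraNneq nw => /(congr1 (@ord_pred _)).
    by rewrite /= !ordSK => ->.
  - by rewrite mat_pow shift_full rmorph1 mul1r.
apply: cyc_basis_of_ind => //.
- apply/matrixP => i j; rewrite summxE !mxE (bigD1 i) //= big1 => [|w nw].
    by rewrite addr0 mxE eqxx /= eq_sym.
  by rewrite mxE eq_sym (negPf nw).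
- by move=> v l a b; rewrite /mat_coef mxE.
- by move=> v l d a; rewrite /mat_coef -[sc _ d * a]/(d%:M *m a) mul_scalar_mx mxE.
- move=> v l w j ln jn; rewrite /mat_coef mat_pow mxE.
  have [->|//] := eqVneq v w; rewrite /=; congr (nat_of_bool _)%:R.
  by apply/eqP/eqP => [/shift_inj->|->].
move=> H HD HZ HE a.
have -> : a = \sum_i \sum_j (mat_sc (a i j) * delta_mx i j).
  rewrite [LHS]matrix_sum_delta; apply: eq_bigr => i _; apply: eq_bigr => j _.
  by rewrite -[RHS]/(_ *m _) mul_scalar_mx.
have H0 : H 0.
  rewrite -(mul0r (mat_e ord0 * mat_y ^+ 0)) -(rmorph0 (sc mat_salg)).
  exact/HZ/HE.
elim/big_ind: _ => // i _; elim/big_ind: _ => // j _; apply: HZ.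
(* The matrix unit at (i, j) is e_i y^l with l congruent to j - i modulo n + 1; adding n + 1 first
   avoids truncated subtraction. *)
have -> : j = shift ((j + (n.+1 - i)) %% n.+1)%N i.
  apply: val_inj; rewrite [RHS]val_shift modnDmr addnCA subnKC ?(ltnW (ltn_ord i)) //.
  by rewrite modnDr modn_small.
by rewrite -mat_pow; exact: HE.
Qed.
End MatrixBasis.

(** * Eigenvalue idempotents over the prime field *)

Section PolyEval.
Variables (k : fieldType) (A : salg k).
Implicit Types (a b u : A) (P Q : {poly k}) (c : k).

Definition peval a P : A := \sum_(i < size P) sc A P`_i * a ^+ i.

Lemma pevalw N a P : (size P <= N)%N ->
  peval a P = \sum_(i < N) sc A P`_i * a ^+ i.
Proof.
move=> PN; rewrite /peval (big_ord_widen _ (fun i => sc A P`_i * a ^+ i) PN).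
rewrite big_mkcond; apply: eq_bigr => i _; case: ltnP => // Pi.
by rewrite nth_default // rmorph0 mul0r.
Qed.

Fact peval_zmod a : zmod_morphism (peval a).
Proof.
move=> P Q; pose N := maxn (size P) (size Q).
rewrite !(@pevalw N) ?leq_maxl ?leq_maxr //; last first.
  by rewrite (leq_trans (size_polyD _ _)) // size_polyN.
by rewrite -sumrB; apply: eq_bigr => i _; rewrite coefB rmorphB mulrBl.
Qed.
HB.instance Definition _ a :=
  GRing.isZmodMorphism.Build {poly k} A (peval a) (peval_zmod a).

Lemma pevalZ a c P : peval a (c *: P) = sc A c * peval a P.
Proof.
rewrite (pevalw _ (size_scale_leq c P)) mulr_sumr; apply: eq_bigr => i _.
by rewrite coefZ rmorphM mulrA.
Qed.

Lemma pevalXM a P : peval a ('X * P) = a * peval a P.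
Proof.
rewrite (@pevalw (size P).+1) ?(leq_trans (size_polyMleq _ _)) ?size_polyX //.
rewrite big_ord_recl coefXM rmorph0 mul0r add0r mulr_sumr; apply: eq_bigr => i _.
by rewrite coefXM /= exprS !mulrA scC.
Qed.

Lemma peval1 a : peval a 1 = 1.
Proof. by rewrite /peval size_poly1 big_ord1 coef1 rmorph1 mulr1. Qed.

Lemma pevalXn a i : peval a 'X^i = a ^+ i.
Proof. by elim: i => [|i IH]; [exact: peval1|rewrite !exprS pevalXM IH]. Qed.

Lemma pevalX a : peval a 'X = a.
Proof. by rewrite -['X]expr1 pevalXn expr1. Qed.

Lemma pevalM a P Q : peval a (P * Q) = peval a P * peval a Q.
Proof.
elim/poly_ind: P => [|P c IH]; first by rewrite mul0r !raddf0 mul0r.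
rewrite mulrDl !raddfD /= mulrDl mul_polyC pevalZ; congr (_ + _).
  by rewrite [P * 'X]mulrC -mulrA !pevalXM IH mulrA.
by rewrite -[c%:P]mulr1 mul_polyC pevalZ peval1 mulr1.
Qed.

Lemma peval_eigen a u c P : a * u = sc A c * u ->
  peval a P * u = sc A P.[c] * u.
Proof.
move=> au; have auX i : a ^+ i * u = sc A (c ^+ i) * u.
  elim: i => [|i IH]; first by rewrite !expr0 rmorph1.
  by rewrite exprSr -mulrA au mulr_sc IH mulrA -rmorphM -exprS.
rewrite /peval mulr_suml horner_coef raddf_sum mulr_suml /=.
by apply: eq_bigr => i _; rewrite -mulrA auX mulrA rmorphM.
Qed.

Lemma peval_comm a u P : a * u = u * a -> peval a P * u = u * peval a P.
Proof.
move=> au; rewrite /peval mulr_suml mulr_sumr; apply: eq_bigr => i _.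
by rewrite -mulrA mulr_sc; congr (_ * _); exact/esym/commrX.
Qed.
End PolyEval.

Lemma rmorph_peval (k : fieldType) (A B : salg k) (f : {rmorphism A -> B}) :
  (forall c, f (sc A c) = sc B c) ->
  forall a P, f (peval a P) = peval (f a) P.
Proof.
move=> fsc a P; rewrite /peval rmorph_sum; apply: eq_bigr => i _.
by rewrite rmorphM rmorphXn /= fsc.
Qed.

Section PrimeField.
Variables (k : fieldType) (p : nat).
Hypotheses (hk : p \in [pchar k]).
Let p_pr : prime p. Proof. by case/andP: hk. Qed.
Let p_gt0 : (0 < p)%N := prime_gt0 p_pr.
Let p_gt1 : (1 < p)%N := prime_gt1 p_pr.
Let predpK : p.-1.+1 = p := prednK p_gt0.
Let pnat_p : [pchar k].-nat p.
Proof. by rewrite pnatE // inE p_pr; case/andP: hk. Qed.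
Implicit Types c d : k.

(** The prime field inside k, as the fixed points of Frobenius. *)
Definition fp c := c ^+ p == c.

Lemma fpB c d : fp c -> fp d -> fp (c - d).
Proof. by move=> /eqP cp /eqP dp; rewrite /fp exprDn_pchar // exprNn_pchar // cp dp. Qed.
Lemma fp0 : fp 0. Proof. by rewrite /fp expr0n gtn_eqF. Qed.
Lemma fpN c : fp c -> fp (- c). Proof. by rewrite -(sub0r c); exact/fpB/fp0. Qed.
Lemma fpD c d : fp c -> fp d -> fp (c + d).
Proof. by move=> fc fd; rewrite -(opprK d); apply/fpB/fpN. Qed.
Lemma fpM c d : fp c -> fp d -> fp (c * d).
Proof. by move=> /eqP cp /eqP dp; rewrite /fp exprMn cp dp. Qed.
Lemma fpV c : fp c -> fp c^-1.
Proof. by move=> /eqP cp; rewrite /fp exprVn cp. Qed.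
Lemma fp1 : fp 1. Proof. by rewrite /fp expr1n. Qed.
Lemma fpX c i : fp c -> fp (c ^+ i).
Proof. by move=> /eqP cp; rewrite /fp exprAC cp. Qed.
Lemma fp_nat i : fp i%:R.
Proof. by elim: i => [|i IH]; rewrite ?fp0 // -addn1 natrD fpD // fp1. Qed.
Lemma fp_sum (I : Type) (r : seq I) (P : pred I) (F : I -> k) :
  (forall i, P i -> fp (F i)) -> fp (\sum_(i <- r | P i) F i).
Proof. by move=> FP; elim/big_ind: _ => //; [exact: fp0|exact: fpD]. Qed.

Lemma natr_inj i j : (i < p)%N -> (j < p)%N -> i%:R = j%:R :> k -> i = j.
Proof.
wlog ij : i j / (i <= j)%N => [H ip jp E|ip jp E].
  by case/orP: (leq_total i j) => /H; [|move=> H']; [exact|apply/esym/H'].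
apply/eqP; rewrite eqn_leq ij -subn_eq0 /=; apply: contraT => nz.
have : (p %| j - i)%N by rewrite (dvdn_pcharf hk) natrB // E subrr.
by move/dvdn_leq; rewrite lt0n nz leqNgt (leq_ltn_trans (leq_subr _ _)) // => /(_ isT).
Qed.

Definition fpoly_idem c : {poly k} := 1 - ('X - c%:P) ^+ p.-1.

Lemma fpoly_idem_eval c d : fp c -> fp d -> (fpoly_idem c).[d] = (c == d)%:R.
Proof.
move=> fc fd; rewrite /fpoly_idem !hornerE.
have [->|cd] := eqVneq c d;
  first by rewrite subrr expr0n -subn1 subn_eq0 leqNgt p_gt1 subr0.
have nz : d - c != 0 by rewrite subr_eq0 eq_sym.
apply/eqP; rewrite subr_eq0 eq_sym; apply/eqP/(mulfI nz).
by rewrite -exprS predpK (eqP (fpB fd fc)) mulr1.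
Qed.

(** (X - c) E_c = (X - c) - (X - c)^p, which is X - X^p by Frobenius when c^p = c. Hence E_c(x) is
    an eigenvector of x as soon as x^p = x. *)
Lemma fpoly_idem_mul c : fp c -> 'X * fpoly_idem c = c *: fpoly_idem c + ('X - 'X^p).
Proof.
move=> /eqP fc.
have Pp : [pchar {poly k}].-nat p.
  by rewrite pnatE // inE p_pr -(rmorph_nat (@polyC k)) polyC_eq0; case/andP: hk.
have <- : ('X - c%:P) * fpoly_idem c = 'X - 'X^p.
  rewrite /fpoly_idem mulrBr mulr1 -exprS predpK exprDn_pchar // exprNn_pchar //.
  by rewrite -rmorphXn /= fc opprB addrA subrK.
by rewrite mulrBl mul_polyC addrC subrK.
Qed.

Lemma size_fpoly_idem c : (size (fpoly_idem c) <= p)%N.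
Proof.
rewrite (leq_trans (size_polyD _ _)) // size_polyN size_poly1 geq_max p_gt0.
by rewrite size_exp_XsubC predpK leqnn.
Qed.

Lemma coef_fpoly_idem c : (fpoly_idem c)`_p.-1 = -1.
Proof.
rewrite coefB coef1 -subn1 subn_eq0 leqNgt p_gt1 sub0r subn1; congr (- _).
have := monicXsubC c => /(monic_exp p.-1)/monicP.
by rewrite lead_coefE size_exp_XsubC.
Qed.

(** Both sides have degree less than p and agree at the p distinct points g t. *)
Lemma fp_interp (g : 'I_p -> k) (P : {poly k}) :
  (forall t, fp (g t)) -> injective g -> (size P <= p)%N ->
  \sum_t P.[g t] *: fpoly_idem (g t) = P.
Proof.
move=> fg ginj sP; apply/eqP; rewrite -subr_eq0; apply/eqP.
apply: (@roots_geq_poly_eq0 _ _ [seq g t | t : 'I_p]).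
- apply/allP => _ /mapP[t _ ->]; rewrite rootE hornerD hornerN horner_sum.
  rewrite (bigD1 t) //= big1 => [|s st]; rewrite hornerZ fpoly_idem_eval //.
    by rewrite eqxx mulr1 addr0 subrr.
  by rewrite (inj_eq ginj) (negPf st) mulr0.
- by rewrite map_inj_uniq ?enum_uniq.
rewrite size_map size_enum_ord (leq_trans (size_polyD _ _)) // size_polyN geq_max sP.
rewrite andbT (leq_trans (size_sum _ _ _)) //; apply/bigmax_leqP => t _.
by rewrite (leq_trans (size_scale_leq _ _)) ?size_fpoly_idem.
Qed.

Section Idempotents.
Variable A : salg k.
Implicit Types x y u : A.
Definition idem x c : A := peval x (fpoly_idem c).

Lemma idem_comm x c u : x * u = u * x -> idem x c * u = u * idem x c.
Proof. exact: peval_comm. Qed.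

Lemma idem_eigen_mul x u c d : fp c -> fp d -> x * u = sc A d * u ->
  idem x c * u = if c == d then u else 0.
Proof.
move=> fc fd /peval_eigen->; rewrite fpoly_idem_eval //.
by case: eqP => _; rewrite ?rmorph1 ?mul1r // rmorph0 mul0r.
Qed.

Variable x : A.
Hypothesis xp : x ^+ p = x.

Lemma idem_eigen c : fp c -> x * idem x c = sc A c * idem x c.
Proof.
move=> fc; have x0 : peval x ('X - 'X^p) = 0.
  by rewrite raddfB /= pevalXn pevalX xp subrr.
by rewrite -pevalXM (fpoly_idem_mul fc) raddfD /= pevalZ x0 addr0.
Qed.

Lemma idem_orth c d : fp c -> fp d -> idem x c * idem x d = if c == d then idem x c else 0.
Proof.
move=> fc fd; rewrite (idem_eigen_mul fc fd (idem_eigen fd)).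
by case: eqP => // ->.
Qed.

Lemma idem_sum (g : 'I_p -> k) : (forall t, fp (g t)) -> injective g ->
  \sum_t idem x (g t) = 1.
Proof.
move=> fg ginj; rewrite -(peval1 x) -(fp_interp fg ginj (P := 1)) ?size_poly1 //.
rewrite raddf_sum; apply: eq_bigr => t _.
by rewrite /= hornerE scale1r.
Qed.
End Idempotents.
End PrimeField.

(** * Blocks of a central element *)

Section Diagonal.
Variables (k : fieldType) (n m : nat) (kap : k) (T : salg k).
Variables (e : 'I_n.+1 -> T) (y : T).
Hypotheses (S : cyc_sys m kap e y) (e1 : \sum_v e v = 1).
Implicit Types (g : 'I_n.+1 -> k).

Lemma sum1_extl (a b : T) : (forall v, e v * a = e v * b) -> a = b.
Proof.
move=> ab; rewrite -[a]mul1r -[b]mul1r -e1 !mulr_suml.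
by apply: eq_bigr => v _.
Qed.

Lemma sum1_extr (a b : T) : (forall v, a * e v = b * e v) -> a = b.
Proof.
move=> ab; rewrite -[a]mulr1 -[b]mulr1 -e1 !mulr_sumr.
by apply: eq_bigr => v _.
Qed.

Definition diag g : T := \sum_v sc T (g v) * e v.

Lemma diag_e g v : diag g * e v = sc T (g v) * e v.
Proof.
rewrite mulr_suml (bigD1 v) //= -mulrA (cs_orth S) eqxx big1 ?addr0 // => w nw.
by rewrite -mulrA (cs_orth S) (negPf nw) mulr0.
Qed.

Lemma e_diag g v : e v * diag g = sc T (g v) * e v.
Proof.
rewrite mulr_sumr (bigD1 v) //= mulr_sc (cs_orth S) eqxx big1 ?addr0 // => w nw.
by rewrite mulr_sc (cs_orth S) eq_sym (negPf nw) mulr0.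
Qed.

Lemma diagXn g i v : diag g ^+ i * e v = sc T (g v ^+ i) * e v.
Proof.
elim: i => [|i IH]; first by rewrite !expr0 rmorph1.
by rewrite exprSr -mulrA diag_e mulr_sc IH mulrA -rmorphM -exprS.
Qed.

Lemma diag_comm g h : diag g * diag h = diag h * diag g.
Proof.
apply: sum1_extr => v; rewrite -!mulrA !diag_e !mulr_sc !diag_e.
by rewrite !mulrA scC.
Qed.

Lemma e_diag_y g v : e v * (diag g * y) = sc T (g v) * (e v * y).
Proof. by rewrite mulrA e_diag mulrA. Qed.

Lemma e_y_diag g v : e v * (y * diag g) = sc T (g (ordS v)) * (e v * y).
Proof.
by rewrite mulrA (cs_shift S) -mulrA e_diag mulr_sc.
Qed.

Lemma lie_diag_y g h : (forall v, g v - g (ordS v) = h (ordS v)) ->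
  lie (diag g) y = y * diag h.
Proof.
move=> gh; apply: sum1_extl => v.
by rewrite mulrBr e_diag_y !e_y_diag -mulrBl -rmorphB gh.
Qed.

Lemma diag1 : diag (fun=> 1) = 1.
Proof. by rewrite -e1; apply: eq_bigr => v _; rewrite rmorph1 mul1r. Qed.

Lemma peval_diag g P v : peval (diag g) P * e v = sc T P.[g v] * e v.
Proof. exact/peval_eigen/diag_e. Qed.

Lemma peval_diagE g P : peval (diag g) P = diag (fun v => P.[g v]).
Proof. by apply: sum1_extr => v; rewrite peval_diag diag_e. Qed.
End Diagonal.

(** Inserting 1 as the sum of the e_w to the right of y leaves only the term w = v + 1. *)
Lemma cs_shift_intro (k : fieldType) n (A : salg k) (e : 'I_n.+1 -> A) (y : A) :
  \sum_v e v = 1 ->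
  (forall v w, e v * (y * e w) = if w == ordS v then y * e w else 0) ->
  forall v, e v * y = y * e (ordS v).
Proof.
move=> e1 ey v; rewrite -[y in LHS]mulr1 -e1 !mulr_sumr (bigD1 (ordS v)) //=.
by rewrite ey eqxx big1 ?addr0 // => w nw; rewrite ey (negPf nw).
Qed.

Section Components.
Variables (k : fieldType) (n : nat).
Local Notation p := n.+1.
Hypothesis hk : p \in [pchar k].
Let p_pr : prime p. Proof. by case/andP: hk. Qed.

(** The eigenvalue of x at vertex v. The sign is imposed by e_v y = y e_(v+1): left multiplication
    by y raises the eigenvalue by 1, so it must drop from v to v + 1. *)
Definition av (v : 'I_p) : k := - v%:R.
Lemma fp_av v : fp p (av v). Proof. exact/fpN/fp_nat. Qed.
Lemma av_inj : injective av.
Proof.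
move=> v w /oppr_inj E; apply: val_inj.
exact: (natr_inj hk (ltn_ord v) (ltn_ord w) E).
Qed.
Lemma av_ordS v : av (ordS v) = av v - 1.
Proof. by rewrite /av /= (GRing.natr_mod_pchar hk) -addn1 natrD opprD. Qed.

Section Source.
Variables (A : salg k) (x y : A).
Hypotheses (xy : lie x y = y) (xp : x ^+ p = x).

Lemma x_eigen_y u c : x * u = sc A c * u -> x * (y * u) = sc A (c + 1) * (y * u).
Proof.
move=> xu; have -> : x * (y * u) = y * (x * u) + y * u.
  by rewrite !mulrA -mulrDl -[X in y * x + X]xy /lie addrC subrK.
by rewrite xu mulr_sc rmorphD mulrDl rmorph1 mul1r.
Qed.

Definition xe v := idem p x (av v).
Lemma xe_sum : \sum_v xe v = 1.
Proof. exact: (idem_sum hk _ fp_av av_inj). Qed.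
Lemma xe_orth v w : xe v * xe w = if v == w then xe v else 0.
Proof. by rewrite idem_orth ?fp_av // (inj_eq av_inj). Qed.
Lemma x_xe v : x * xe v = sc A (av v) * xe v.
Proof. exact/idem_eigen/fp_av. Qed.
Lemma xe_shift v : xe v * y = y * xe (ordS v).
Proof.
apply: cs_shift_intro xe_sum _ v => v w.
rewrite (idem_eigen_mul hk _ _ (x_eigen_y (x_xe w))) ?fpD ?fp_av ?fp1 //.
by rewrite -subr_eq -av_ordS (inj_eq av_inj) eq_sym.
Qed.
Lemma xe_diag : \sum_v sc A (av v) * xe v = x.
Proof.
rewrite -[RHS]mulr1 -xe_sum mulr_sumr; apply: eq_bigr => v _.
by rewrite x_xe.
Qed.
End Source.

Section Component.
Variables (A : salg k) (x y z : A).
Hypotheses (xy : lie x y = y) (xz : lie x z = 0) (yz : lie y z = 0).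
Hypotheses (xp : x ^+ p = x) (zp : z ^+ p = z).
Variables (kap : k) (T : salg k) (e : 'I_p -> T) (Y : T) (cf : 'I_p -> nat -> T -> k).
Hypothesis bas : cyc_basis p kap e Y cf.
Variables (c u : k).
Hypotheses (fc : fp p c) (u0 : u != 0).
Hypothesis yp : idem p z c * y ^+ p = sc A (u ^+ p * kap) * idem p z c.
Variable f : {rmorphism A -> T}.
Hypotheses (fsc : forall d, f (sc A d) = sc T d) (fx : f x = diag e av)
  (fy : f y = sc T u * Y) (fz : f z = sc T c).

Let zc := idem p z c.
Let zcx : zc * x = x * zc.
Proof. by apply: idem_comm; apply/eqP; rewrite eq_sym -subr_eq0; apply/eqP. Qed.
Let zcy : zc * y = y * zc.
Proof. by apply: idem_comm; apply/eqP; rewrite eq_sym -subr_eq0; apply/eqP. Qed.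
Let zcxe v : zc * xe x v = xe x v * zc.
Proof. by apply/esym; apply: idem_comm; apply/esym. Qed.
Let zcc : zc * zc = zc.
Proof. by rewrite (idem_orth hk zp) // eqxx. Qed.

Definition comp_e v : A := idem p z c * xe x v.
(** The rescaling makes the p-th power of this element act as kap on the block where z = c. Its uses
    are u = 1, kap = 0 for nilpotent y, and u = c, kap = 1 where y^p = z = c is nonzero, as c^p =
    c. *)
Definition comp_y : A := sc A u^-1 * y.

Lemma comp_sys : cyc_sys p kap comp_e comp_y.
Proof.
split=> [v w|v|v]; rewrite /comp_e /comp_y -/zc.
- rewrite -mulrA [xe x v * _]mulrA -zcxe -mulrA xe_orth // mulrA zcc.
  by case: eqP; rewrite ?mulr0 // mulrA zcc.
- rewrite mulr_sc -[RHS]mulrA; congr (_ * _).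
  by rewrite -mulrA xe_shift // !mulrA zcy.
have yX i : comp_y ^+ i = sc A (u^-1 ^+ i) * y ^+ i.
  elim: i => [|i IH]; first by rewrite !expr0 rmorph1 mulr1.
  by rewrite exprS IH /comp_y -mulrA mulr_sc mulrA -rmorphM -!exprS.
rewrite [X in _ * X]yX mulr_sc zcxe -mulrA yp mulr_sc mulrA -rmorphM.
rewrite [u^-1 ^+ _ * _]mulrA.
by rewrite -exprMn mulVf // expr1n mul1r.
Qed.

Let S := comp_sys.
Definition comp_psi := psi p cf comp_e comp_y.

Lemma comp_sum : \sum_v comp_e v = idem p z c.
Proof. by rewrite -mulr_sumr xe_sum // mulr1. Qed.

Lemma comp_psi_f1 : comp_psi (f 1) = idem p z c.
Proof. by rewrite rmorph1 /comp_psi (psi1 bas) ?comp_sum. Qed.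

Lemma comp_psi_fx : comp_psi (f x) = idem p z c * x.
Proof.
rewrite fx /diag /comp_psi (psi_sum bas) -[x in RHS](xe_diag xp) mulr_sumr.
apply: eq_bigr => v _.
by rewrite (psiZ bas) (psi_e bas) // [RHS]mulr_sc.
Qed.

Lemma comp_psi_fy : comp_psi (f y) = idem p z c * y.
Proof.
rewrite fy /comp_psi (psiZ bas) (psi_y bas) // comp_sum /comp_y mulr_sc.
by rewrite mulrA -rmorphM mulfV // rmorph1 mul1r.
Qed.

Lemma comp_psi_fz : comp_psi (f z) = idem p z c * z.
Proof.
rewrite fz -[sc T c]mulr1 /comp_psi (psiZ bas) (psi1 bas) // comp_sum.
by rewrite -(idem_eigen hk zp) //; apply/esym/idem_comm.
Qed.

(** Since f sends z to the scalar c, it sends the central idempotent of the block to 1, hence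
    [comp_e v] to e_v and [comp_y] to Y; the rest follows on the basis. *)
Lemma comp_fK a : f (comp_psi a) = a.
Proof.
have f1 v : f (comp_e v) = e v.
  rewrite rmorphM !(rmorph_peval fsc) fx fz.
  apply: (sum1_extr (cb_sum bas)) => w.
  have ew : peval (diag e av) (fpoly_idem p (av v)) * e w = if v == w then e w else 0.
    rewrite (peval_diag (cb_sys bas)) fpoly_idem_eval ?fp_av // (inj_eq av_inj).
    by case: eqP; rewrite ?rmorph1 ?mul1r // rmorph0 mul0r.
  rewrite -mulrA ew (cs_orth (cb_sys bas)).
  case: eqP => [->|_]; last by rewrite mulr0.
  have /peval_eigen-> : sc T c * e w = sc T c * e w by [].
  by rewrite fpoly_idem_eval // eqxx rmorph1 mul1r.
have fY : f comp_y = Y.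
  by rewrite rmorphM fsc fy mulrA -rmorphM mulVf // rmorph1 mul1r.
have fZ d b : f (sc A d * b) = sc T d * f b by rewrite rmorphM fsc.
elim/(basis_ind bas): a => [a b IHa IHb|d a IH|v l].
- by rewrite /comp_psi (psiD bas) rmorphD IHa IHb.
- by rewrite /comp_psi (psiZ bas) fZ IH.
by rewrite /comp_psi (psiE bas) // rmorphM rmorphXn /= f1 fY.
Qed.

(** The image of [comp_psi] lies in the block where z = c, and f' kills the idempotent of that block
    because it sends z to another scalar. *)
Lemma comp_f0 (T' : salg k) (f' : {rmorphism A -> T'}) d :
  (forall b, f' (sc A b) = sc T' b) -> f' z = sc T' d -> fp p d -> c != d ->
  forall a, f' (comp_psi a) = 0.
Proof.
move=> f'sc f'z fd cd a.
have f'zc : f' (idem p z c) = 0.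
  rewrite (rmorph_peval f'sc) f'z -[peval _ _]mulr1.
  have /peval_eigen-> : sc T' d * 1 = sc T' d * 1 by [].
  by rewrite fpoly_idem_eval // (negPf cd) rmorph0 mul0r.
rewrite -[a]mul1r /comp_psi (psiM bas) // (psi1 bas) // comp_sum.
by rewrite rmorphM f'zc mul0r.
Qed.
End Component.
End Components.

(** * The relations of the four algebras *)

Lemma all_six (T : eqType) (P : T -> Prop) (a b c d e g : T) :
  (forall r, r \in [:: a; b; c; d; e; g] -> P r) <->
  [/\ P a, P b, P c, P d & P e /\ P g].
Proof.
split=> [H|[Pa Pb Pc Pd [Pe Pg]] r].
  by split; [| | | |split]; apply: H; rewrite !inE eqxx ?orbT.
by rewrite !inE => /or4P[/eqP->//|/eqP->//|/eqP->//|/or3P[/eqP->//|/eqP->//|/eqP->//]].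
Qed.

Section RelationImages.
Variables (k : fieldType) (F : lalgType k) (B : salg k) (f : {rmorphism F -> B}).
Hypothesis fZ : forall c a, f (c *: a) = sc B c * f a.
Implicit Types a b c : F.

Lemma rmorph_lie a b : f (lie a b) = lie (f a) (f b).
Proof. by rewrite rmorphB !rmorphM. Qed.

Lemma rel_lie a b c : f (lie a b - c) = 0 <-> lie (f a) (f b) = f c.
Proof.
rewrite rmorphB rmorph_lie; split=> [/eqP|->]; last exact: subrr.
by rewrite subr_eq0 => /eqP.
Qed.

Lemma rel_lie0 a b : f (lie a b) = 0 <-> lie (f a) (f b) = 0.
Proof. by rewrite rmorph_lie. Qed.

Lemma rel_pow a b i : f (a ^+ i - b) = 0 <-> f a ^+ i = f b.
Proof.
rewrite rmorphB rmorphXn; split=> [/eqP|->]; last exact: subrr.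
by rewrite subr_eq0 => /eqP.
Qed.

Lemma rel_pow0 a i : f (a ^+ i) = 0 <-> f a ^+ i = 0.
Proof. by rewrite rmorphXn. Qed.

Lemma rmorph_poly a p (d : nat -> k) :
  f (\sum_(1 <= i < p) d i *: a ^+ i) = peval (f a) (\sum_(1 <= i < p) d i *: 'X^i).
Proof.
rewrite !raddf_sum; apply: eq_bigr => i _ /=.
by rewrite fZ rmorphXn pevalZ pevalXn.
Qed.

Variables (x y z : F) (p : nat).
Let X : B := f x.
Let Y : B := f y.
Let Z : B := f z.

Lemma relB2_iff (d : nat -> k) :
  (forall r, r \in [:: lie x y - y; lie x z;
     lie y z - y * (\sum_(1 <= i < p) d i *: x ^+ i);
     x ^+ p - x; y ^+ p; z ^+ p - z] -> f r = 0) <->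
  [/\ lie X Y = Y, lie X Z = 0,
      lie Y Z = Y * peval X (\sum_(1 <= i < p) d i *: 'X^i),
      X ^+ p = X & Y ^+ p = 0 /\ Z ^+ p = Z].
Proof.
rewrite (all_six (fun r => f r = 0)) -rmorph_poly -rmorphM.
by split=> -[/rel_lie ? /rel_lie0 ? /rel_lie ? /rel_pow ? [/rel_pow0 ? /rel_pow ?]].
Qed.

Lemma relC12_iff : (forall r, r \in [:: lie x y - y; lie x z; lie y z;
     x ^+ p - x; y ^+ p - z; z ^+ p] -> f r = 0) <->
  [/\ lie X Y = Y, lie X Z = 0, lie Y Z = 0, X ^+ p = X & Y ^+ p = Z /\ Z ^+ p = 0].
Proof.
rewrite (all_six (fun r => f r = 0)).
by split=> -[/rel_lie ? /rel_lie0 ? /rel_lie0 ? /rel_pow ? [/rel_pow ? /rel_pow0 ?]].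
Qed.

Lemma relC13_iff : (forall r, r \in [:: lie x y - y; lie x z; lie y z;
     x ^+ p - x; y ^+ p; z ^+ p - z] -> f r = 0) <->
  [/\ lie X Y = Y, lie X Z = 0, lie Y Z = 0, X ^+ p = X & Y ^+ p = 0 /\ Z ^+ p = Z].
Proof.
rewrite (all_six (fun r => f r = 0)).
by split=> -[/rel_lie ? /rel_lie0 ? /rel_lie0 ? /rel_pow ? [/rel_pow0 ? /rel_pow ?]].
Qed.

Lemma relC14_iff : (forall r, r \in [:: lie x y - y; lie x z; lie y z;
     x ^+ p - x; y ^+ p - z; z ^+ p - z] -> f r = 0) <->
  [/\ lie X Y = Y, lie X Z = 0, lie Y Z = 0, X ^+ p = X & Y ^+ p = Z /\ Z ^+ p = Z].
Proof.
rewrite (all_six (fun r => f r = 0)).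
by split=> -[/rel_lie ? /rel_lie0 ? /rel_lie0 ? /rel_pow ? [/rel_pow ? /rel_pow ?]].
Qed.
End RelationImages.

Definition X0 : 'I_3 := @Ordinal 3 0 isT.
Definition X1 : 'I_3 := @Ordinal 3 1 isT.
Definition X2 : 'I_3 := @Ordinal 3 2 isT.

Section Relations.
Variables (k : fieldType) (p : nat) (B : salg k) (b : 'I_3 -> B).
Local Notation X := (b X0).
Local Notation Y := (b X1).
Local Notation Z := (b X2).

Definition fB2 : {poly k} :=
  \sum_(1 <= i < p) ((-1) ^+ (i - 1) * (p - i)%:R^-1) *: 'X^i.

Definition relB2 :=
  [/\ lie X Y = Y, lie X Z = 0, lie Y Z = Y * peval X fB2,
      X ^+ p = X & Y ^+ p = 0 /\ Z ^+ p = Z].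
Definition relC12 :=
  [/\ lie X Y = Y, lie X Z = 0, lie Y Z = 0, X ^+ p = X & Y ^+ p = Z /\ Z ^+ p = 0].
Definition relC13 :=
  [/\ lie X Y = Y, lie X Z = 0, lie Y Z = 0, X ^+ p = X & Y ^+ p = 0 /\ Z ^+ p = Z].
Definition relC14 :=
  [/\ lie X Y = Y, lie X Z = 0, lie Y Z = 0, X ^+ p = X & Y ^+ p = Z /\ Z ^+ p = Z].

Lemma relsB2P : (forall r, r \in relsB2 k p -> free_eval b r = 0) <-> relB2.
Proof.
have := @relB2_iff _ _ _ (free_eval b) (free_evalZ b)
  << fmu X0 >> << fmu X1 >> << fmu X2 >> p.
move=> /(_ (fun i => (-1) ^+ (i - 1) * (p - i)%:R^-1)).
by rewrite /= !free_evalU; exact.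
Qed.

Lemma relsC12P : (forall r, r \in relsC12 k p -> free_eval b r = 0) <-> relC12.
Proof.
have := @relC12_iff _ _ _ (free_eval b) << fmu X0 >> << fmu X1 >> << fmu X2 >> p.
by rewrite /= !free_evalU; exact.
Qed.

Lemma relsC13P : (forall r, r \in relsC13 k p -> free_eval b r = 0) <-> relC13.
Proof.
have := @relC13_iff _ _ _ (free_eval b) << fmu X0 >> << fmu X1 >> << fmu X2 >> p.
by rewrite /= !free_evalU; exact.
Qed.

Lemma relsC14P : (forall r, r \in relsC14 k p -> free_eval b r = 0) <-> relC14.
Proof.
have := @relC14_iff _ _ _ (free_eval b) << fmu X0 >> << fmu X1 >> << fmu X2 >> p.
by rewrite /= !free_evalU; exact.
Qed.
End Relations.

(** * Generators, universal property and gluing of blocks *)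

Lemma ord3_ind (P : 'I_3 -> Prop) : P X0 -> P X1 -> P X2 -> forall i, P i.
Proof.
move=> P0 P1 P2 [[|[|[|//]]] lt].
- by rewrite (_ : Ordinal lt = X0) //; apply: val_inj.
- by rewrite (_ : Ordinal lt = X1) //; apply: val_inj.
- by rewrite (_ : Ordinal lt = X2) //; apply: val_inj.
Qed.

Definition three (T : Type) (x y z : T) (i : 'I_3) : T :=
  match val i with 0 => x | 1 => y | _ => z end.

Section Presented.
Variable k : fieldType.

(** Stated for bare functions, because the maps it is applied to are composites with [psi], or sums
    of such composites, which come without a bundled morphism structure. *)
Definition generates (A : salg k) (g : 'I_3 -> A) := forall f : A -> A,
  f 1 = 1 -> (forall a b, f (a + b) = f a + f b) ->
  (forall a b, f (a * b) = f a * f b) ->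
  (forall c a, f (sc A c * a) = sc A c * f a) ->
  (forall i, f (g i) = g i) -> forall a, f a = a.

Record presented (R : forall B : salg k, ('I_3 -> B) -> Prop) (A : salg k)
    (g : 'I_3 -> A) : Prop := Presented {
  presented_rel : R A g;
  presented_gen : generates g;
  presented_lift : forall (B : salg k) (b : 'I_3 -> B), R B b ->
    exists f : {rmorphism A -> B},
      (forall c, f (sc A c) = sc B c) /\ (forall i, f (g i) = b i) }.

Lemma pres_presented (rels : seq (freeAlg k)) R :
  (forall (B : salg k) (b : 'I_3 -> B),
    (forall r, r \in rels -> free_eval b r = 0) <-> R B b) ->
  presented R (gen rels).
Proof.
move=> relsR; split=> [||B b]; first exact/relsR/pres_rel.
  exact: pres_ext.
by move/relsR; exact: pres_lift.
Qed.
End Presented.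

Section Glue.
Variables (k : fieldType) (A : salg k) (g : 'I_3 -> A) (C : finType).
Hypothesis gen_g : generates g.
Variable G : C -> A -> A.
Hypotheses (GD : forall c a b, G c (a + b) = G c a + G c b)
  (GM : forall c a b, G c (a * b) = G c a * G c b)
  (GZ : forall c d a, G c (sc A d * a) = sc A d * G c a)
  (G0 : forall c d, c != d -> G c 1 * G d 1 = 0)
  (G1 : \sum_c G c 1 = 1)
  (Gg : forall i, \sum_c G c (g i) = g i).

Lemma glue a : \sum_c G c a = a.
Proof.
apply: (gen_g (f := fun a => \sum_c G c a)) => // [b d|b d|d b].
- by rewrite -big_split; apply: eq_bigr => c _; rewrite GD.
- rewrite mulr_suml; apply: eq_bigr => c _.
  rewrite mulr_sumr (bigD1 c) //= GM big1 ?addr0 // => c' cc'.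
  rewrite -[b]mulr1 -[d]mul1r !GM -mulrA [G c 1 * _]mulrA G0 1?eq_sym //.
  by rewrite mul0r mulr0.
- by rewrite mulr_sumr; apply: eq_bigr => c _; rewrite GZ.
Qed.
End Glue.

Lemma ffun_rmorph (A B : pzRingType) (C : finType) (f : C -> {rmorphism A -> B}) :
  exists F : {rmorphism A -> {ffun C -> B}}, forall a c, F a c = f c a.
Proof.
pose g a := [ffun c => f c a].
have gB : zmod_morphism g.
  by move=> a b; apply/ffunP => c; rewrite !ffunE rmorphB.
have gM : monoid_morphism g.
  split=> [|a b]; apply/ffunP => c; first by rewrite !ffunE rmorph1.
  by rewrite !ffunE rmorphM.
pose mB := GRing.isZmodMorphism.Build A {ffun C -> B} g gB.
pose mM := GRing.isMonoidMorphism.Build A {ffun C -> B} g gM.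
pose G : {rmorphism A -> {ffun C -> B}} := HB.pack g mB mM.
by exists G => a c; rewrite ffunE.
Qed.

Lemma pair_rmorph (A B C : pzRingType) (f : {rmorphism A -> B}) (g : {rmorphism A -> C}) :
  exists F : {rmorphism A -> (B * C)%type}, forall a, F a = (f a, g a).
Proof.
pose h a := (f a, g a).
have hB : zmod_morphism h by move=> a b; rewrite /h !rmorphB.
have hM : monoid_morphism h by split=> [|a b]; rewrite /h ?rmorph1 ?rmorphM.
pose mB := GRing.isZmodMorphism.Build A (B * C)%type h hB.
pose mM := GRing.isMonoidMorphism.Build A (B * C)%type h hM.
pose G : {rmorphism A -> (B * C)%type} := HB.pack h mB mM.
by exists G.
Qed.

(** * Isomorphisms for C12, C13 and C14 *)

Section TargetRelations.
Variables (k : fieldType) (n m : nat) (kap : k) (T : salg k).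
Variables (e : 'I_n.+1 -> T) (y : T).
Hypotheses (S : cyc_sys m kap e y) (e1 : \sum_v e v = 1).

Lemma lie_sc (a : T) c : lie a (sc T c) = 0.
Proof. by rewrite /lie scC subrr. Qed.

Lemma lie_scr (a b : T) c : lie a (sc T c * b) = sc T c * lie a b.
Proof. by rewrite /lie mulr_sc -mulrA -mulrBr. Qed.

Lemma lie_diag_shift (a : 'I_n.+1 -> k) : (forall v, a (ordS v) = a v - 1) ->
  lie (diag e a) y = y.
Proof.
move=> aS; rewrite (lie_diag_y S e1 (h := fun=> 1)) ?(diag1 e1) ?mulr1 // => v.
by rewrite aS opprB addrC subrK.
Qed.

Lemma sys_powm : y ^+ m = sc T kap.
Proof.
apply: (sum1_extl e1) => v.
by rewrite (cs_pow S) scC.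
Qed.

Lemma diag_fp p (a : 'I_n.+1 -> k) : (forall v, fp p (a v)) ->
  diag e a ^+ p = diag e a.
Proof.
move=> fa; apply: (sum1_extr e1) => v.
by rewrite (diagXn S) (diag_e S) (eqP (fa v)).
Qed.

Lemma idem_diag p (hk : p \in [pchar k]) (a : 'I_n.+1 -> k) c w :
  (forall v, fp p (a v)) -> fp p c ->
  idem p (diag e a) c * e w = if c == a w then e w else 0.
Proof. by move=> fa fc; apply: (idem_eigen_mul hk); rewrite ?(diag_e S). Qed.
End TargetRelations.

Lemma sc_pow (k : fieldType) (A : salg k) c (a : A) i :
  (sc A c * a) ^+ i = sc A (c ^+ i) * a ^+ i.
Proof. by rewrite exprMn_comm ?rmorphXn //; exact: scC. Qed.

Section IsoOfSystem.
Variables (k : fieldType) (A : salg k) (g : 'I_3 -> A).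
Hypothesis gen_g : generates g.
Variables (n m : nat) (kap : k) (T : salg k) (e : 'I_n.+1 -> T) (y : T).
Variable (cf : 'I_n.+1 -> nat -> T -> k).
Hypotheses (bas : cyc_basis m kap e y cf) (m_gt0 : (0 < m)%N).
Variables (e' : 'I_n.+1 -> A) (y' : A).
Hypotheses (S' : cyc_sys m kap e' y') (e'1 : \sum_v e' v = 1).
Variable f : {rmorphism A -> T}.
Hypotheses (fsc : forall c, f (sc A c) = sc T c) (fe : forall v, f (e' v) = e v)
  (fy : f y' = y) (fg : forall i, psi m cf e' y' (f (g i)) = g i).

Lemma iso_of_system : bijective f.
Proof.
exists (psi m cf e' y') => a.
  apply: (gen_g (f := psi m cf e' y' \o f)) => //= [|b d|b d|c b].
  - by rewrite rmorph1 (psi1 bas).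
  - by rewrite rmorphD (psiD bas).
  - by rewrite rmorphM (psiM bas).
  - by rewrite rmorphM fsc (psiZ bas).
have fZ d b : f (sc A d * b) = sc T d * f b by rewrite rmorphM fsc.
elim/(basis_ind bas): a => [a b IHa IHb|d a IH|v l].
- by rewrite (psiD bas) rmorphD IHa IHb.
- by rewrite (psiZ bas) fZ IH.
by rewrite (psiE bas) // rmorphM rmorphXn /= fe fy.
Qed.

Lemma psi_diag a (x : A) : (forall v, x * e' v = sc A (a v) * e' v) ->
  psi m cf e' y' (diag e a) = x.
Proof.
move=> xe; rewrite /diag (psi_sum bas) -[x]mulr1 -e'1 mulr_sumr.
by apply: eq_bigr => v _; rewrite xe (psiZ bas) (psi_e bas).
Qed.
End IsoOfSystem.

Section IsoC.
Variables (k : fieldType) (n : nat).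
Local Notation p := n.+1.
Hypothesis hk : p \in [pchar k].
Let p_pr : prime p. Proof. by case/andP: hk. Qed.

Variables (A : salg k) (g : 'I_3 -> A).

Lemma C12_iso : presented (@relC12 k p) g ->
  forall (T : salg k) (e : 'I_p -> T) Y cf, cyc_basis (p ^ 2) 0 e Y cf ->
  exists f : {rmorphism A -> T}, (forall c, f (sc A c) = sc T c) /\ bijective f.
Proof.
have m_gt0 : (0 < p ^ 2)%N by rewrite expn_gt0.
case=> -[xy xz yz xp [yp zp]] gen_g univ T e Y cf bas.
have S := cb_sys bas; have e1 := cb_sum bas.
have [f [fsc fg]] : exists f : {rmorphism A -> T}, (forall c, f (sc A c) = sc T c) /\
    (forall i, f (g i) = three (diag e (@av k n)) Y (Y ^+ p) i).
  apply: univ; rewrite /relC12 /three /=; split.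
  - exact: (lie_diag_shift S e1 (av_ordS hk)).
  (* There are p vertices, so p steps lead back to v; thus Y^p commutes with the e_v and can serve
     as the image of z. *)
  - have eY v : e v * Y ^+ p = Y ^+ p * e v by rewrite (sys_shift S) shift_full.
    apply/eqP; rewrite subr_eq0 /diag mulr_suml mulr_sumr; apply/eqP.
    by apply: eq_bigr => v _; rewrite -mulrA eY mulr_sc.
  - by rewrite /lie -exprS -exprSr subrr.
  - exact/(diag_fp S e1)/fp_av.
  - by split=> //; rewrite -exprM mulnn (sys_powm S e1) rmorph0.
exists f; split=> //.
set x := g X0 in xy xz xp; set y := g X1 in xy yz yp.
set z := g X2 in xz yz yp zp.
have S' : cyc_sys (p ^ 2) 0 (@xe k n A x) y.
  split=> [v w|v|v]; [exact: xe_orth|exact: xe_shift|].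
  by rewrite -mulnn exprM yp zp mulr0 rmorph0 mul0r.
have e'1 := xe_sum hk x.
have fx : f x = diag e (@av k n) by rewrite fg.
have fy : f y = Y by rewrite fg.
apply: (iso_of_system gen_g bas m_gt0 S') => //.
- move=> v; rewrite (rmorph_peval fsc) fx; apply: (sum1_extr e1) => w.
  rewrite (idem_diag S hk) ?fp_av //; last by move=> ?; exact: fp_av.
  by rewrite (inj_eq (av_inj hk)) (cs_orth S); case: eqP => // ->.
- apply: ord3_ind; rewrite fg /three /=.
  + by apply: (psi_diag bas) => // v; exact: x_xe.
  + by rewrite (psi_y bas) // e'1 mul1r.
  (* Y^p is written as a sum of paths of length p, on which [psi] is known. *)
  + have -> : Y ^+ p = \sum_v e v * Y ^+ p by rewrite -mulr_suml e1 mul1r.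
    rewrite (psi_sum bas) -/z -yp -[y ^+ p]mul1r -e'1 mulr_suml.
    by apply: eq_bigr => v _; rewrite (psiE bas).
Qed.

Section ComponentTarget.
Variables (kap : k) (T : salg k) (e : 'I_p -> T) (Y : T).
Hypotheses (S : cyc_sys p kap e Y) (e1 : \sum_v e v = 1).
Variables (c u : k).
Hypothesis fc : fp p c.
Local Notation X' := (diag e (@av k n)).
Local Notation Y' := (sc T u * Y).
Local Notation Z' := (sc T c).

Lemma comp_target : [/\ lie X' Y' = Y', lie X' Z' = 0, lie Y' Z' = 0,
  X' ^+ p = X' & Y' ^+ p = sc T (u ^+ p * kap) /\ Z' ^+ p = Z'].
Proof.
split; [| exact: lie_sc|exact: lie_sc| |split].
- by rewrite lie_scr (lie_diag_shift S e1 (av_ordS hk)).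
- exact/(diag_fp S e1)/fp_av.
- by rewrite sc_pow (sys_powm S e1) rmorphM.
- by rewrite -rmorphXn /= (eqP fc).
Qed.
End ComponentTarget.

Let nat_fp (t : 'I_p) : fp p (t%:R : k). Proof. exact: fp_nat. Qed.
Let nat_inj : injective (fun t : 'I_p => t%:R : k).
Proof. by move=> s t /(natr_inj hk (ltn_ord s) (ltn_ord t)) E; exact: val_inj. Qed.

(* H is the projection of A onto the block of A cut out by the central          *)
(* idempotent idem p (g X2) c.                                                  *)
Record block_proj (c : k) (H : A -> A) : Prop := BlockProj {
  block_D : forall a b, H (a + b) = H a + H b;
  block_M : forall a b, H (a * b) = H a * H b;
  block_Z : forall d a, H (sc A d * a) = sc A d * H a;
  block_1 : H 1 = idem p (g X2) c;
  block_g : forall i, H (g i) = idem p (g X2) c * g i }.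

Lemma block_glue (G : 'I_p -> A -> A) : generates g -> g X2 ^+ p = g X2 ->
  (forall t : 'I_p, block_proj t%:R (G t)) -> forall a, \sum_t G t a = a.
Proof.
move=> gen_g zp GP a.
apply: (glue gen_g (G := G)) => [t b b'|t b b'|t d b|s t st||i].
- by case: (GP t).
- by case: (GP t).
- by case: (GP t).
- rewrite !(block_1 (GP _)) (idem_orth hk zp) // (inj_eq nat_inj).
  by rewrite (negPf st).
- rewrite (eq_bigr _ (fun t _ => block_1 (GP t))).
  exact: (idem_sum hk _ nat_fp nat_inj).
rewrite (eq_bigr _ (fun t _ => block_g (GP t) i)) -mulr_suml.
by rewrite (idem_sum hk _ nat_fp nat_inj) mul1r.
Qed.

Section BlockOfComponent.
Local Notation x := (g X0).
Local Notation y := (g X1).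
Local Notation z := (g X2).
Hypotheses (xy : lie x y = y) (xz : lie x z = 0) (yz : lie y z = 0).
Hypotheses (xp : x ^+ p = x) (zp : z ^+ p = z).
Variables (kap : k) (T : salg k) (e : 'I_p -> T) (Y : T) (cf : 'I_p -> nat -> T -> k).
Hypothesis bas : cyc_basis p kap e Y cf.
Variables (c u : k).
Hypotheses (fc : fp p c) (u0 : u != 0).
Hypothesis yp : idem p z c * y ^+ p = sc A (u ^+ p * kap) * idem p z c.
Variable f : {rmorphism A -> T}.
Hypotheses (fsc : forall d, f (sc A d) = sc T d)
  (fg : forall i, f (g i) = three (diag e (@av k n)) (sc T u * Y) (sc T c) i).

Lemma comp_block : block_proj c (fun a => comp_psi x y z cf c u (f a)).
Proof.
have CS := comp_sys hk xy xz yz xp zp fc u0 yp.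
have [fx fy fz] : [/\ f x = diag e (@av k n), f y = sc T u * Y & f z = sc T c].
  by rewrite !fg.
split=> [a b|a b|d a||].
- by rewrite rmorphD /comp_psi (psiD bas).
- by rewrite rmorphM /comp_psi (psiM bas).
- by rewrite rmorphM fsc /comp_psi (psiZ bas).
- exact: (comp_psi_f1 hk xy xz yz xp zp bas).
apply: ord3_ind.
- exact: (comp_psi_fx hk xy xz yz xp zp bas).
- exact: (comp_psi_fy hk xy xz yz xp zp bas).
- exact: (comp_psi_fz hk xy xz yz xp zp bas).
Qed.

Lemma comp_block_fK a : f (comp_psi x y z cf c u a) = a.
Proof. by apply: (comp_fK hk xy xz yz xp zp bas); rewrite ?fg. Qed.

Lemma comp_block_f0 (T' : salg k) (f' : {rmorphism A -> T'}) d :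
  (forall b, f' (sc A b) = sc T' b) -> f' z = sc T' d -> fp p d -> c != d ->
  forall a, f' (comp_psi x y z cf c u a) = 0.
Proof. exact: (comp_f0 hk xy xz yz xp zp bas). Qed.
End BlockOfComponent.

Lemma C13_iso : presented (@relC13 k p) g ->
  forall (T : salg k) (e : 'I_p -> T) Y cf, cyc_basis p 0 e Y cf ->
  exists f : {rmorphism A -> {ffun 'I_p -> T}},
  (forall c a t, f (sc A c * a) t = sc _ c * f a t) /\ bijective f.
Proof.
case=> -[xy xz yz xp [yp zp]] gen_g univ T e Y cf bas.
have S := cb_sys bas; have e1 := cb_sum bas.
have exf (t : 'I_p) : exists f : {rmorphism A -> T}, (forall c, f (sc A c) = sc T c) /\
    (forall i, f (g i) = three (diag e (@av k n)) (sc T 1 * Y) (sc T t%:R) i).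
  apply: univ; rewrite /relC13 /three /=.
  have := comp_target S e1 1 (nat_fp t).
  by rewrite mulr0 rmorph0.
have [f fP] := choice exf.
have ypc c : idem p (g X2) c * g X1 ^+ p = sc A (1 ^+ p * 0) * idem p (g X2) c.
  by rewrite yp !mulr0 rmorph0 mul0r.
pose psi (t : 'I_p) := comp_psi (g X0) (g X1) (g X2) cf t%:R 1.
have u0 : 1 != 0 :> k := oner_neq0 k.
have [F FE] := ffun_rmorph f.
exists F; split=> [c a t|]; first by rewrite !FE rmorphM (fP t).1.
have GK : forall a, \sum_t psi t (f t a) = a.
  apply: (block_glue (G := fun t a => psi t (f t a)) gen_g zp) => t.
  exact: (comp_block xy xz yz xp zp bas (nat_fp t) u0 (ypc _) (fP t).1 (fP t).2).
exists (fun r : {ffun 'I_p -> T} => \sum_t psi t (r t)) => [a|r].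
  by rewrite -[RHS]GK; apply: eq_bigr => t _; rewrite FE.
apply/ffunP => s; rewrite FE raddf_sum (bigD1 s) //= big1 => [|t ts].
  rewrite addr0.
  exact: (comp_block_fK xy xz yz xp zp bas (nat_fp s) u0 (ypc _) (fP s).1 (fP s).2).
have fz : f s (g X2) = sc T s%:R by rewrite (fP s).2.
apply: (comp_block_f0 xy xz yz xp zp bas (nat_fp t) u0 (ypc _) (fP s).1 fz (nat_fp s)).
by rewrite (inj_eq nat_inj).
Qed.

Lemma C14_iso : presented (@relC14 k p) g ->
  forall (T : salg k) (e : 'I_p -> T) Y cf, cyc_basis p 0 e Y cf ->
  forall (M : salg k) (eM : 'I_p -> M) YM cfM, cyc_basis p 1 eM YM cfM ->
  exists f : {rmorphism A -> (T * {ffun 'I_n -> M})%type},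
  [/\ forall c a, (f (sc A c * a)).1 = sc _ c * (f a).1,
      forall c a t, (f (sc A c * a)).2 t = sc _ c * (f a).2 t & bijective f].
Proof.
case=> -[xy xz yz xp [yp zp]] gen_g univ T e Y cf bas M eM YM cfM basM.
have S := cb_sys bas; have e1 := cb_sum bas.
have SM := cb_sys basM; have eM1 := cb_sum basM.
(* [lift ord0 i] is i + 1, so c runs over the nonzero elements of the prime field, one for each
   matrix block. *)
pose c (i : 'I_n) : k := (lift ord0 i)%:R.
have fc i : fp p (c i) by exact: nat_fp.
have c0 i : c i != 0.
  apply/eqP => /(natr_inj hk (ltn_ord (lift ord0 i)) (ltn0Sn n)).
  by rewrite lift0.
have [f0 [f0sc f0g]] : exists f : {rmorphism A -> T},
    (forall c, f (sc A c) = sc T c) /\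
    (forall i, f (g i) = three (diag e (@av k n)) (sc T 1 * Y) (sc T 0) i).
  apply: univ; rewrite /relC14 /three /=.
  by have := comp_target S e1 1 (fp0 hk); rewrite mulr0.
have exf (i : 'I_n) : exists f : {rmorphism A -> M},
    (forall c, f (sc A c) = sc M c) /\
    (forall j, f (g j) = three (diag eM (@av k n)) (sc M (c i) * YM) (sc M (c i)) j).
  apply: univ; rewrite /relC14 /three /=.
  by have := comp_target SM eM1 (c i) (fc i); rewrite mulr1 (eqP (fc i)).
have [fM fMP] := choice exf.
have ypc d : fp p d -> idem p (g X2) d * g X1 ^+ p = sc A d * idem p (g X2) d.
  by move=> fd; rewrite yp -(idem_eigen hk zp fd); exact: idem_comm.
have yp0 : idem p (g X2) 0 * g X1 ^+ p = sc A (1 ^+ p * 0) * idem p (g X2) 0.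
  by rewrite mulr0; exact/ypc/fp0.
have ypM i : idem p (g X2) (c i) * g X1 ^+ p =
    sc A (c i ^+ p * 1) * idem p (g X2) (c i).
  by rewrite mulr1 (eqP (fc i)); exact/ypc/fc.
pose psi0 := comp_psi (g X0) (g X1) (g X2) cf 0 1.
pose psiM i := comp_psi (g X0) (g X1) (g X2) cfM (c i) (c i).
have u0 : 1 != 0 :> k := oner_neq0 k.
(* All p blocks are indexed together, with the nilpotent one at t = 0, so that [block_glue]
   applies. *)
pose G (t : 'I_p) : A -> A := if unlift ord0 t is Some i
  then fun a => psiM i (fM i a) else fun a => psi0 (f0 a).
have GK a : psi0 (f0 a) + \sum_i psiM i (fM i a) = a.
  rewrite -[RHS](block_glue (G := G) gen_g zp) => [|t].
    rewrite big_ord_recl /G unlift_none; congr (_ + _).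
    by apply: eq_bigr => i _; rewrite liftK.
  rewrite /G; case: (unliftP ord0 t) => [i ->|->].
    exact: (comp_block xy xz yz xp zp basM (fc i) (c0 i) (ypM i)
      (fMP i).1 (fMP i).2).
  exact: (comp_block xy xz yz xp zp bas (fp0 hk) u0 yp0 f0sc f0g).
have [F2 F2E] := ffun_rmorph fM; have [F FE] := pair_rmorph f0 F2.
exists F; split=> [d a|d a t|].
- by rewrite FE rmorphM f0sc FE.
- by rewrite !FE !F2E rmorphM (fMP t).1.
exists (fun r : (T * {ffun 'I_n -> M})%type =>
  psi0 r.1 + \sum_i psiM i (r.2 i)) => [a|[r M']].
  rewrite -[RHS]GK FE; congr (_ + _); apply: eq_bigr => i _.
  by rewrite F2E.
have f0z : f0 (g X2) = sc T 0 by rewrite f0g.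
have fMz i : fM i (g X2) = sc M (c i) by rewrite (fMP i).2.
rewrite FE; congr (_, _) => /=.
  have -> : f0 (psi0 r + \sum_i psiM i (M' i)) =
      f0 (psi0 r) + \sum_i f0 (psiM i (M' i))
    by rewrite rmorphD; congr (_ + _); exact: rmorph_sum.
  rewrite [X in _ + X]big1 => [|i _].
    rewrite addr0.
    exact: (comp_block_fK xy xz yz xp zp bas (fp0 hk) u0 yp0 f0sc f0g).
  exact: (comp_block_f0 xy xz yz xp zp basM (fc i) (c0 i) (ypM i) f0sc f0z (fp0 hk)).
apply/ffunP => s; rewrite F2E.
have -> : fM s (psi0 r + \sum_i psiM i (M' i)) =
    fM s (psi0 r) + \sum_i fM s (psiM i (M' i))
    by rewrite rmorphD; congr (_ + _); exact: rmorph_sum.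
have -> : fM s (psi0 r) = 0.
  apply: (comp_block_f0 xy xz yz xp zp bas (fp0 hk) u0 yp0 (fMP s).1 (fMz s) (fc s)).
  by rewrite eq_sym.
rewrite add0r (bigD1 s) //= [X in _ + X]big1 => [|t ts].
  rewrite addr0.
  exact: (comp_block_fK xy xz yz xp zp basM (fc s) (c0 s) (ypM s)
    (fMP s).1 (fMP s).2).
apply: (comp_block_f0 xy xz yz xp zp basM (fc t) (c0 t) (ypM t) (fMP s).1 (fMz s) (fc s)).
by rewrite /c (inj_eq nat_inj) (inj_eq lift_inj).
Qed.
End IsoC.

(** * The algebra B2 *)

Section SumOverPrimeField.
Variables (k : fieldType) (p : nat).
Hypothesis hk : p \in [pchar k].
Let p_pr : prime p. Proof. by case/andP: hk. Qed.
Let p_gt1 : (1 < p)%N := prime_gt1 p_pr.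

(* Compare the coefficients of degree p - 1 in Lagrange interpolation. *)
Lemma fp_power_sum (g : 'I_p -> k) (P : {poly k}) :
  (forall t, fp p (g t)) -> injective g -> (size P <= p)%N ->
  \sum_t P.[g t] = - P`_p.-1.
Proof.
move=> fg ginj sP; rewrite -{2}(fp_interp hk fg ginj sP) coef_sum -sumrN.
by apply: eq_bigr => t _; rewrite coefZ coef_fpoly_idem // mulrN1 opprK.
Qed.

Lemma size_fB2 : (size (fB2 k p) <= p)%N.
Proof.
rewrite /fB2 big_nat_cond; apply: (leq_trans (size_sum _ _ _)).
apply/bigmax_leqP_seq => i _ /andP[/andP[_ ip] _].
by rewrite (leq_trans (size_scale_leq _ _)) // size_polyXn.
Qed.

(** Only the summand i = p - 1 contributes, with coefficient a sign times the inverse of 1. *)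
Lemma coef_fB2 : (fB2 k p)`_p.-1 != 0.
Proof.
rewrite /fB2; case: p p_gt1 => [|[|n]] // _; rewrite big_nat_recr //= coefD coef_sum.
rewrite big_nat_cond big1 => [|i /andP[/andP[_ ip] _]].
  rewrite add0r coefZ coefXn eqxx mulr1 subSnn invr1 mulr1.
  by rewrite expf_neq0 // oppr_eq0 oner_neq0.
by rewrite coefZ coefXn gtn_eqF // mulr0.
Qed.

Lemma fp_fB2 c : fp p c -> fp p (fB2 k p).[c].
Proof.
move=> fc; rewrite horner_sum; apply: fp_sum => // i _; rewrite hornerZ hornerXn.
apply: fpM; last exact: fpX.
apply: fpM; last exact/fpV/fp_nat.
by apply/fpX/fpN/fp1.
Qed.

Definition bsum (i : nat) : k := \sum_(j < i) (fB2 k p).[- (j.+1)%:R].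

Lemma fp_bsum i : fp p (bsum i).
Proof. by apply: fp_sum => // j _; apply/fp_fB2/fpN/fp_nat. Qed.

Lemma bsumS i : bsum i.+1 = bsum i + (fB2 k p).[- (i.+1)%:R].
Proof. by rewrite /bsum big_ord_recr. Qed.

Lemma natr_inj_ord : injective (fun t : 'I_p => - (t.+1)%:R : k).
Proof.
move=> s t /oppr_inj; rewrite -[s.+1]addn1 -[t.+1]addn1 !natrD => /addIr E.
exact/val_inj/(natr_inj hk (ltn_ord s) (ltn_ord t) E).
Qed.

Lemma bsum_p : bsum p != 0.
Proof.
rewrite /bsum (fp_power_sum (g := fun t : 'I_p => - (t.+1)%:R)).
- by rewrite oppr_eq0 coef_fB2.
- by move=> t; apply/fpN/fp_nat.
- exact: natr_inj_ord.
- exact: size_fB2.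
Qed.

(** The summands depend on the index modulo p only, so each full period contributes [bsum p]. *)
Lemma bsum_add i t : bsum (t * p + i) = bsum i + t%:R * bsum p.
Proof.
have step j : bsum (p + j) = bsum p + bsum j.
  elim: j => [|j IH]; first by rewrite addn0 [bsum 0]big_ord0 addr0.
  rewrite addnS !bsumS IH addrA; congr (_ + _.[- _]).
  by rewrite -addnS natrD (pcharf0 hk) add0r.
elim: t => [|t IH]; first by rewrite mul0r addr0.
by rewrite mulSn -addnA step IH -(addn1 t) natrD mulrDl mul1r addrC addrA.
Qed.
End SumOverPrimeField.

Section IsoB2.
Variables (k : fieldType) (p q : nat).
Hypotheses (hk : p \in [pchar k]) (hq : q.+1 = (p ^ 2)%N).
Let p_pr : prime p. Proof. by case/andP: hk. Qed.
Let p_gt0 : (0 < p)%N := prime_gt0 p_pr.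
Local Notation f := (fB2 k p).
Local Notation b := (bsum k p).

Definition a2 (v : 'I_q.+1) : k := - v%:R.
(* (a2 v, b2 v) is the vertex reached from (0, 0) by v steps of the inverse of *)
(* (i, j) |-> (i + 1, j - f(i)), since e v y = y e (v + 1).                    *)
Definition b2 (v : 'I_q.+1) : k := b v.

Let fpa v : fp p (a2 v). Proof. exact/fpN/fp_nat. Qed.
Let fpb v : fp p (b2 v). Proof. exact: fp_bsum. Qed.

Lemma b_full : b q.+1 = 0.
Proof.
by rewrite hq -mulnn -[(p * p)%N]addn0 bsum_add // (pcharf0 hk) mul0r
  [b 0]big_ord0 addr0.
Qed.

Lemma a2_ordS v : a2 (ordS v) = a2 v - 1.
Proof.
rewrite /a2 /= -(GRing.natr_mod_pchar hk).
have -> : (v.+1 %% q.+1 %% p = v.+1 %% p)%N by rewrite modn_dvdm // hq dvdn_exp.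
by rewrite (GRing.natr_mod_pchar hk) -addn1 natrD opprD.
Qed.

(** At the last vertex the index wraps to 0; the recursion survives because the p^2 steps of the
    full cycle sum to p times [bsum p], that is to 0 ([b_full]). *)
Lemma b2_ordS v : b2 (ordS v) = b2 v + f.[a2 (ordS v)].
Proof.
have -> : f.[a2 (ordS v)] = f.[- (v.+1)%:R] by rewrite a2_ordS -addn1 natrD opprD.
rewrite /b2 -bsumS /=; have := ltn_ord v; rewrite leq_eqVlt => /orP[/eqP E|lt].
  by rewrite E modnn b_full [b 0]big_ord0.
by rewrite modn_small.
Qed.

(** The eigenvalue of x determines v modulo p. With that residue fixed, the eigenvalue of z
    determines the quotient of v by p, since [bsum p] is nonzero. *)
Lemma ab_inj v w : a2 v = a2 w -> b2 v = b2 w -> v = w.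
Proof.
have lt (u : 'I_q.+1) : (u %/ p < p)%N by rewrite ltn_divLR // mulnn -hq.
move=> /oppr_inj; rewrite -(GRing.natr_mod_pchar hk) -[RHS](GRing.natr_mod_pchar hk).
move=> /(natr_inj hk); rewrite !ltn_mod => /(_ p_gt0 p_gt0) E.
rewrite /b2 (divn_eq v p) (divn_eq w p) !bsum_add // E => /addrI.
move=> /(mulIf (bsum_p hk)) /(natr_inj hk (lt v) (lt w)) E'.
by apply: val_inj; rewrite /= (divn_eq v p) (divn_eq w p) E E'.
Qed.

Section SourceB2.
Variables (A : salg k) (x y z : A).
Hypotheses (xy : lie x y = y) (xz : lie x z = 0) (yz : lie y z = y * peval x f).
Hypotheses (xp : x ^+ p = x) (zp : z ^+ p = z).

Definition e2 v : A := idem p x (a2 v) * idem p z (b2 v).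

Let xzC : x * z = z * x.
Proof. by apply/eqP; rewrite -subr_eq0; apply/eqP. Qed.
Let idemC c d : idem p x c * idem p z d = idem p z d * idem p x c.
Proof. by apply: idem_comm; apply/esym; apply: idem_comm; exact/esym. Qed.

Lemma x_e2 v : x * e2 v = sc A (a2 v) * e2 v.
Proof. by rewrite /e2 mulrA (idem_eigen hk xp (fpa v)) mulrA. Qed.

Lemma z_e2 v : z * e2 v = sc A (b2 v) * e2 v.
Proof. by rewrite /e2 idemC mulrA (idem_eigen hk zp (fpb v)) mulrA. Qed.

Lemma e2_mul u v (c d : k) : fp p c -> fp p d -> x * u = sc A c * u ->
  z * u = sc A d * u -> e2 v * u = if (a2 v == c) && (b2 v == d) then u else 0.
Proof.
move=> fc fd xu zu; rewrite /e2 -mulrA (idem_eigen_mul hk (fpb v) fd zu).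
rewrite andbC; case: eqP => _ /=; last by rewrite mulr0.
exact: (idem_eigen_mul hk (fpa v) fc xu).
Qed.

Lemma ab_eq v w : (a2 v == a2 w) && (b2 v == b2 w) = (v == w).
Proof.
by apply/andP/eqP => [[/eqP /ab_inj H /eqP /H]|->].
Qed.

Lemma e2_orth v w : e2 v * e2 w = if v == w then e2 v else 0.
Proof.
rewrite (e2_mul v (fpa w) (fpb w) (x_e2 w) (z_e2 w)) ab_eq.
by case: eqP => // ->.
Qed.

(** Writing v = t p + s, for fixed s the eigenvalues b s + t (b p) of z exhaust the prime field as t
    varies, so the idempotents of z sum to 1; the sum over s then does the same for x. *)
Lemma e2_sum : \sum_v e2 v = 1.
Proof.
have lt (st : 'I_p * 'I_p) : (st.2 * p + st.1 < q.+1)%N.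
  rewrite hq -mulnn; apply: (@leq_trans (st.2.+1 * p)%N);
    last by rewrite leq_mul2r ltn_ord orbT.
  by rewrite mulSn addnC ltn_add2r ltn_ord.
pose h st : 'I_q.+1 := Ordinal (lt st).
have h_bij : bijective h.
  apply: inj_card_bij => [[s t] [s' t']|]; last by rewrite card_prod !card_ord mulnn hq.
  move/(congr1 val) => /= E.
  have Es : s = s'.
    apply: val_inj; move: (congr1 (modn^~ p) E).
    by rewrite !modnMDl !modn_small.
  have Et : t = t'.
    apply: val_inj; move: (congr1 (divn^~ p) E).
    by rewrite !divnMDl // !divn_small // !addn0.
  by rewrite Es Et.
rewrite (reindex h) /=; last exact: onW_bij.
rewrite -(pair_bigA _ (fun s t => e2 (h (s, t)))) /=.
rewrite -(idem_sum hk x (g := fun s : 'I_p => - s%:R)); last first.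
- by move=> s t /oppr_inj E; exact/val_inj/(natr_inj hk (ltn_ord s) (ltn_ord t) E).
- by move=> s; apply/fpN/fp_nat.
apply: eq_bigr => s _; rewrite -[RHS]mulr1.
rewrite -(idem_sum hk z (g := fun t : 'I_p => b s + t%:R * b p)); last first.
- move=> t t' /addrI /(mulIf (bsum_p hk)) E.
  exact/val_inj/(natr_inj hk (ltn_ord t) (ltn_ord t') E).
- move=> t; apply: fpD => //; first exact: fp_bsum.
  by apply: fpM; [exact: fp_nat|exact: fp_bsum].
rewrite mulr_sumr; apply: eq_bigr => t _; rewrite /e2 /a2 /b2 /= bsum_add //.
by rewrite natrD natrM (pcharf0 hk) mulr0 add0r.
Qed.

(** The relation reads z y = y z - y f(x), and f(x) acts on u as the scalar f(c). *)
Lemma z_eigen_y u c d : x * u = sc A c * u -> z * u = sc A d * u ->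
  z * (y * u) = sc A (d - f.[c]) * (y * u).
Proof.
move=> xu zu; have -> : z * (y * u) = y * (z * u) - y * (peval x f * u).
  by rewrite !mulrA -mulrBl -yz /lie opprB addrC subrK.
by rewrite (peval_eigen _ xu) zu !mulr_sc -mulrBl -rmorphB.
Qed.

Lemma e2_shift v : e2 v * y = y * e2 (ordS v).
Proof.
apply: cs_shift_intro e2_sum _ v => v w.
rewrite (e2_mul v _ _ (x_eigen_y xy (x_e2 w)) (z_eigen_y (x_e2 w) (z_e2 w))).
- have -> : (a2 v == a2 w + 1) && (b2 v == b2 w - f.[a2 w]) = (w == ordS v) => //.
  rewrite -ab_eq a2_ordS -subr_eq [in RHS]eq_sym.
  case: eqP => //= E; rewrite b2_ordS a2_ordS E.
  by rewrite eq_sym subr_eq.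
- by apply: fpD => //; exact: fp1.
- by apply: fpB => //; exact: fp_fB2.
Qed.
End SourceB2.

Lemma B2_iso (A : salg k) (g : 'I_3 -> A) : presented (@relB2 k p) g ->
  forall (T : salg k) (e : 'I_q.+1 -> T) Y cf, cyc_basis p 0 e Y cf ->
  exists F : {rmorphism A -> T}, (forall c, F (sc A c) = sc T c) /\ bijective F.
Proof.
case=> -[xy xz yz xp [yp zp]] gen_g univ T e Y cf bas.
have S := cb_sys bas; have e1 := cb_sum bas.
have [F [Fsc Fg]] : exists F : {rmorphism A -> T}, (forall c, F (sc A c) = sc T c) /\
    (forall i, F (g i) = three (diag e a2) Y (diag e b2) i).
  apply: univ; rewrite /relB2 /three /=; split.
  - exact: (lie_diag_shift S e1 a2_ordS).
  - by rewrite /lie (diag_comm S e1) subrr.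
  - rewrite (peval_diagE S e1); apply: (sum1_extl e1) => v.
    rewrite mulrBr !(e_y_diag S) (e_diag_y S) -mulrBl -rmorphB b2_ordS.
    by rewrite [b2 v + _]addrC addrK.
  - exact/(diag_fp S e1).
  - by split; [rewrite (sys_powm S e1) rmorph0|exact/(diag_fp S e1)].
exists F; split=> //.
have S' : cyc_sys p 0 (@e2 A (g X0) (g X2)) (g X1).
  split=> [v w|v|v]; [exact: e2_orth|exact: e2_shift|].
  by rewrite yp mulr0 rmorph0 mul0r.
have e'1 := e2_sum (g X0) (g X2).
have Fx : F (g X0) = diag e a2 by rewrite Fg.
have Fz : F (g X2) = diag e b2 by rewrite Fg.
apply: (iso_of_system gen_g bas p_gt0 S') => //.
- move=> v; rewrite rmorphM !(rmorph_peval Fsc) Fx Fz; apply: (sum1_extr e1) => w.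
  rewrite -mulrA (idem_diag S hk) //.
  have [vw|vw] := eqVneq (b2 v) (b2 w); last first.
    rewrite mulr0 (cs_orth S); case: eqP => // E; by rewrite E eqxx in vw.
  rewrite (idem_diag S hk) // (cs_orth S).
  have [E|E] := eqVneq (a2 v) (a2 w); first by rewrite (ab_inj E vw) eqxx.
  by case: eqP => // E2; rewrite E2 eqxx in E.
- apply: ord3_ind; rewrite Fg /three /=.
  + by apply: (psi_diag bas) => // v; exact: x_e2.
  + by rewrite (psi_y bas) // e'1 mul1r.
  + by apply: (psi_diag bas) => // v; exact: z_e2.
Qed.
End IsoB2.

(** * Absence of a symmetrizing form *)

Section NoTraceForm.
Variables (k : fieldType) (n m : nat) (T : salg k) (e : 'I_n.+1 -> T) (y : T).
Variable cf : 'I_n.+1 -> nat -> T -> k.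
Hypotheses (bas : cyc_basis m 0 e y cf) (m_gt0 : (0 < m)%N).
Hypothesis shift_neq : forall v : 'I_n.+1, shift m.-1 v != v.
Variable lam : T -> k.
Hypotheses (lamD : forall a b, lam (a + b) = lam a + lam b)
  (lamZ : forall c a, lam (sc T c * a) = c * lam a)
  (lamC : forall a b, lam (a * b) = lam (b * a)).

(** The witness is y^(m-1). Paths of positive length annihilate it, and for a longest path q = e_v
    y^(m-1) the trace property gives lam(q) = lam(e_v q) = lam(q e_v) = 0, because q does not end at
    v. *)
Lemma trace_form_degenerate : exists2 l, l != 0 & forall a, lam (a * l) = 0.
Proof.
have S := cb_sys bas.
have lam0 : lam 0 = 0 by rewrite -(mul0r 0) -[X in X * _](rmorph0 (sc T)) lamZ mul0r.
exists (y ^+ m.-1) => [|a].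
  apply/eqP => y0; have lt : (m.-1 < m)%N by rewrite prednK.
  have := cb_dual bas ord0 ord0 lt lt.
  by rewrite y0 mulr0 (cb_coef0 bas) !eqxx => /eqP; rewrite eq_sym oner_eq0.
elim/(basis_ind bas): a => [a b IHa IHb|d a IH|v [|l]].
- by rewrite mulrDl lamD IHa IHb addr0.
- by rewrite -mulrA lamZ IH mulr0.
- have -> : e v * y ^+ 0 * y ^+ m.-1 = e v * (e v * y ^+ m.-1).
    by rewrite mulrA (cs_orth S) eqxx expr0 mulr1.
  rewrite lamC (sys_shift S) -mulrA (cs_orth S) (negPf (shift_neq v)).
  by rewrite mulr0 lam0.
rewrite -mulrA -exprD addSn -addnS prednK // addnC exprD mulrA (cs_pow S).
by rewrite rmorph0 !mul0r lam0.
Qed.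
End NoTraceForm.

(** The form is Phi(1), transported along j: the bimodule property gives Phi(l)(x) = Phi(1)(x l) =
    Phi(1)(l x), hence symmetry, and injectivity of Phi gives nondegeneracy. *)
Lemma symmetric_trace (k : fieldType) (A : salg k) (L : lmodType k) (j : L -> A)
    (mul : L -> L -> L) :
  bijective j -> (forall a b, j (a + b) = j a + j b) ->
  (forall c a, j (c *: a) = sc A c * j a) ->
  (forall a b, j (mul a b) = j a * j b) -> symmetric_alg mul ->
  exists lam : A -> k, [/\ forall a b, lam (a + b) = lam a + lam b,
    forall c a, lam (sc A c * a) = c * lam a,
    forall a b, lam (a * b) = lam (b * a) &
    forall l, (forall a, lam (a * l) = 0) -> l = 0].
Proof.
move=> [h jK hK] jD jZ jM [Phi [PhiL PhiM Phi_inj _]].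
have hD a b : h (a + b) = h a + h b by rewrite -{1}(hK a) -{1}(hK b) -jD jK.
have hZ c a : h (sc A c * a) = c *: h a by rewrite -{1}(hK a) -jZ jK.
have hM a b : h (a * b) = mul (h a) (h b) by rewrite -{1}(hK a) -{1}(hK b) -jM jK.
have m1 a : mul a (h 1) = a by rewrite -{1}(jK a) -hM mulr1 jK.
have m1' a : mul (h 1) a = a by rewrite -{1}(jK a) -hM mul1r jK.
have PhiE l x : Phi l x = Phi (h 1) (mul x l).
  by have := PhiM l (h 1) (h 1) x; rewrite !m1 m1' => ->.
have PhiE' l x : Phi l x = Phi (h 1) (mul l x).
  by have := PhiM (h 1) (h 1) l x; rewrite !m1 m1' => ->.
exists (fun a => Phi (h 1) (h a)); split=> [a b|c a|a b|l lam0].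
- by rewrite hD raddfD.
- by rewrite hZ linearZ.
- by rewrite !hM -PhiE PhiE'.
(* Both functionals vanish: the left one by linearity of Phi, the right one by the hypothesis on l.
   Injectivity then yields h l = 0. *)
have z : Phi (-1 *: h l + h l) =1 Phi (h l).
  by move=> x; rewrite PhiL mulN1r addNr PhiE -(jK x) -hM lam0.
move/Phi_inj: z; rewrite scaleN1r addNr => z; rewrite -(hK l) -z.
have /esym := jD 0 0; rewrite addr0 -[RHS]addr0.
exact: addrI.
Qed.

(** * Selfinjectivity *)

Section ConverseBasis.
Variables (k : fieldType) (n m : nat) (R : salg k) (e : 'I_n.+1 -> R) (y : R).
Variable c : 'I_n.+1 -> nat -> R -> k.
Hypotheses (bas : cyc_basis m 0 e y c) (m_gt0 : (0 < m)%N).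

Definition unshift l (v : 'I_n.+1) := iter l (@ord_pred _) v.

Lemma unshiftK l : cancel (unshift l) (shift l).
Proof.
elim: l => // l IH v; have -> : unshift l.+1 v = unshift l (ord_pred v) by exact: iterSr.
by rewrite /= IH ord_predK.
Qed.

Lemma shiftK l : cancel (shift l) (unshift l).
Proof.
elim: l => // l IH v.
have -> : unshift l.+1 (shift l.+1 v) = unshift l (ord_pred (shift l.+1 v)).
  exact: iterSr.
by rewrite /= ordSK IH.
Qed.

Lemma shift_injl l : injective (shift l : 'I_n.+1 -> 'I_n.+1).
Proof. exact: can_inj (shiftK l). Qed.

Lemma ordS_rev (v : 'I_n.+1) : ordS (rev_ord (ordS v)) = rev_ord v.
Proof.
apply: val_inj => /=; rewrite subSS.
have := ltn_ord v; rewrite leq_eqVlt => /orP[/eqP E|lt].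
  by rewrite E modnn subn0 modnn -E subSS subnn.
by rewrite (modn_small lt) subnSK // modn_small // ltnS leq_subr.
Qed.

Lemma conv_exp (a : R) i : (a : R^c) ^+ i = (a : R) ^+ i.
Proof. by elim: i => // i IH; rewrite exprS exprSr IH. Qed.

Lemma y_e i v : y ^+ i * e v = e (unshift i v) * y ^+ i.
Proof. by rewrite (sys_shift (cb_sys bas)) unshiftK. Qed.

Lemma ym0 : y ^+ m = 0.
Proof.
rewrite -[y ^+ m]mul1r -(cb_sum bas) mulr_suml big1 // => v _.
by rewrite (cs_pow (cb_sys bas)) rmorph0 mul0r.
Qed.

Lemma yge0 i : (m <= i)%N -> y ^+ i = 0.
Proof. by move=> mi; rewrite -(subnKC mi) exprD ym0 mul0r. Qed.

Lemma coef_eY v l w j : (l < m)%N ->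
  c v l (e w * y ^+ j) = ((v == w) && (l == j))%:R.
Proof.
move=> lm; have [jm|mj] := ltnP j m; first exact: (cb_dual bas).
rewrite yge0 // mulr0 (cb_coef0 bas) ltn_eqF ?andbF //.
exact: leq_trans lm mj.
Qed.

Definition conv_e v : conv_salg R := e (rev_ord v).
Definition conv_coef v l (a : conv_salg R) : k := c (unshift l (rev_ord v)) l a.

(** Passing to the opposite algebra reverses the arrows, and reversing the order of the vertices
    restores the orientation. Since y^l e_v = e_(v-l) y^l, the coordinates are re-indexed by
    [unshift]. *)
Lemma conv_basis : cyc_basis m 0 conv_e (y : conv_salg R) conv_coef.
Proof.
have S := cb_sys bas.
have conv_mul (a b : R) : (a : conv_salg R) * b = (b : R) * a by [].
apply: cyc_basis_of_ind => //.
- split=> [v w|v|v].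
  + rewrite conv_mul (cs_orth S) /conv_e (inj_eq rev_ord_inj) eq_sym.
    by case: eqP => // ->.
  + by rewrite !conv_mul /conv_e (cs_shift S) ordS_rev.
  + by rewrite conv_mul conv_exp ym0 mul0r [sc _ 0]rmorph0 mul0r.
- transitivity (\sum_v e v : R); last exact: (cb_sum bas).
  by rewrite [RHS](reindex_inj rev_ord_inj).
- by move=> v l a b; exact: (cb_coefD bas).
- move=> v l d a; rewrite conv_mul /conv_coef.
  by rewrite -[(_ : R) * _](scC (s := R)) (cb_coefZ bas).
- move=> v l w j lm _; rewrite conv_mul conv_exp /conv_e y_e /conv_coef coef_eY //.
  have [->|] := eqVneq l j; last by rewrite !andbF.
  by rewrite !andbT (inj_eq (can_inj (unshiftK j))) (inj_eq rev_ord_inj).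
move=> P PD PZ PE; apply: (basis_ind bas) => [||v l]; [exact: PD| |].
  by move=> d a Pa; rewrite (scC (s := R)); exact: PZ.
have -> : e v * y ^+ l =
    (conv_e (rev_ord (shift l v)) : conv_salg R) * (y : conv_salg R) ^+ l.
  by rewrite conv_mul conv_exp /conv_e rev_ordK (sys_shift S).
exact: PE.
Qed.
End ConverseBasis.

Section FunctionalExtension.
Variables (k : fieldType) (R : salg k) (N : lmodType R).
Local Notation "d *^ x" := (sc R d *: x) (at level 40).

Definition functional_graph (X : set (N * k)) := [/\ X (0, 0),
  forall x y d, X x -> X y -> X (d *^ x.1 + y.1, d * x.2 + y.2) &
  forall d, X (0, d) -> d = 0].

(* Zorn is applied to sets X such that the union of G0 and X is a functional   *)
(* graph, so that the empty chain has an upper bound.                          *)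
Lemma functional_extension (G0 : set (N * k)) : functional_graph G0 ->
  exists h : N -> k, [/\ forall x y, h (x + y) = h x + h y,
    forall d x, h (d *^ x) = d * h x & forall x d, G0 (x, d) -> h x = d].
Proof.
move=> good0; pose P (X : set (N * k)) := functional_graph (setU G0 X).
have [F FP tot|X [[X0 XD Xf] Xmax]] := @Zorn_bigcup _ P.
  have common x y : setU G0 (bigcup F id) x -> setU G0 (bigcup F id) y ->
      exists X, [/\ functional_graph (setU G0 X), setU G0 X x, setU G0 X y &
        subset (setU G0 X) (setU G0 (bigcup F id))].
    have sub X : F X -> subset (setU G0 X) (setU G0 (bigcup F id)).
      by move=> FX z [|Xz]; [left|right; exists X].
    move=> [Gx|[X FX Xx]] [Gy|[Y FY Yy]].
    - by exists set0; rewrite setU0; split=> // z; left.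
    - by exists Y; split; [exact: FP|left|right|exact: sub].
    - by exists X; split; [exact: FP|right|left|exact: sub].
    have [XY|YX] := tot _ _ FX FY.
      by exists Y; split; [exact: FP|right; exact: XY|right|exact: sub].
    by exists X; split; [exact: FP|right|right; exact: YX|exact: sub].
  split=> [|x y d Fx Fy|d Fd]; first by left; case: good0.
    have [X [[_ XD _] Xx Xy sub]] := common _ _ Fx Fy.
    exact/sub/XD.
  have [X [[_ _ Xf] Xx _ _]] := common _ _ Fd Fd.
  exact: Xf.
set G := setU G0 X in X0 XD Xf.
have GZ x d : G x -> G (d *^ x.1, d * x.2).
  by move=> Gx; have := XD _ _ d Gx X0; rewrite !addr0.
have total x : exists d, G (x, d).
  apply: contrapT => nx.
  (* If x lies outside the domain, the functional is extended by the value 0 at x. A conflict with a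
     nonzero multiple of x would put x in the domain after all. *)
  pose X' : set (N * k) := fun z => exists a u, G u /\ z = (u.1 + a *^ x, u.2).
  have X'G : subset G X'.
    by move=> [u d] Gu; exists 0, (u, d); rewrite rmorph0 scale0r addr0.
  have X'x : X' (x, 0).
    by exists 1, (0, 0); rewrite rmorph1 scale1r add0r.
  apply: (Xmax X').
    split=> [z Xz|]; first by apply: X'G; right.
    by move=> XX; apply: nx; exists 0; right; exact: XX.
  rewrite /P; have -> : setU G0 X' = X'.
    by apply/setUidPr => z Gz; apply: X'G; left.
  split=> [|_ _ d [a [u [Gu ->]]] [b [v [Gv ->]]]|d]; first exact/X'G.
    exists (d * a + b), (d *^ u.1 + v.1, d * u.2 + v.2); split; first exact: XD.
    by rewrite /= scalerDr scalerA addrACA rmorphD rmorphM scalerDl.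
  move=> [a [[u d'] [Gu [E ->]]]].
  have [a0|a0] := eqVneq a 0.
    by move: E Gu; rewrite a0 rmorph0 scale0r addr0 => <-; exact: Xf.
  case: nx; exists (- a^-1 * d').
  have -> : x = (- a^-1) *^ u.
    have -> : u = - (a *^ x) by apply/eqP; rewrite -addr_eq0 -E.
    by rewrite scalerN rmorphN scaleNr opprK scalerA -rmorphM mulVf // rmorph1 scale1r.
  exact: (GZ (u, d')).
have [h hP] := choice total.
have uniq x d : G (x, d) -> h x = d.
  move=> Gd; have := XD _ _ (-1) Gd (hP x).
  rewrite /= rmorphN rmorph1 scaleN1r addNr mulN1r => /Xf /eqP.
  by rewrite addrC subr_eq0 => /eqP.
exists h; split=> [x y|d x|x d Gd]; apply: uniq; last by left.
  by have := XD _ _ 1 (hP x) (hP y); rewrite /= rmorph1 scale1r mul1r.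
exact: (GZ (x, h x)).
Qed.
End FunctionalExtension.

Section Frobenius.
Variables (k : fieldType) (n m : nat) (R : salg k) (e : 'I_n.+1 -> R) (y : R).
Variable c : 'I_n.+1 -> nat -> R -> k.
Hypotheses (bas : cyc_basis m 0 e y c) (m_gt0 : (0 < m)%N).
Let S := cb_sys bas.

Definition frob (r : R) : k := \sum_v c v m.-1 r.
(** The path that completes e_v y^l to the longest path from v. These elements are dual to the basis
    for the bilinear form (a, b) -> frob(a b). *)
Definition dual_elt v l : R := e (shift l v) * y ^+ (m.-1 - l).

Lemma frobD a b : frob (a + b) = frob a + frob b.
Proof. by rewrite /frob -big_split; apply: eq_bigr => v _; exact: (cb_coefD bas). Qed.

Lemma frobZ d a : frob (sc R d * a) = d * frob a.
Proof. by rewrite /frob mulr_sumr; apply: eq_bigr => v _; exact: (cb_coefZ bas). Qed.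

Lemma frob0 : frob 0 = 0.
Proof. by rewrite /frob big1 // => v _; exact: (cb_coef0 bas). Qed.

Lemma frob_sum (I : Type) (s : seq I) (F : I -> R) :
  frob (\sum_(i <- s) F i) = \sum_(i <- s) frob (F i).
Proof. exact: (big_morph frob frobD frob0). Qed.

Lemma frob_eY w j : frob (e w * y ^+ j) = (m.-1 == j)%:R.
Proof.
rewrite /frob (bigD1 w) //= (coef_eY bas) ?prednK // eqxx big1 ?addr0 // => v nv.
by rewrite (coef_eY bas) ?prednK // (negPf nv).
Qed.

Lemma pred_sub_eq l j : (l < m)%N -> (m.-1 == j + (m.-1 - l))%N = (l == j).
Proof.
move=> lm; have lm1 : (l <= m.-1)%N by rewrite -ltnS prednK.
by rewrite -{1}(subnKC lm1) eqn_add2r.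
Qed.

Lemma frob_dual s v l : (l < m)%N -> frob (s * dual_elt v l) = c v l s.
Proof.
move=> lm; elim/(basis_ind bas): s => [a b IHa IHb|d a IH|w j].
- by rewrite mulrDl frobD IHa IHb (cb_coefD bas).
- by rewrite -mulrA frobZ IH (cb_coefZ bas).
rewrite (sys_mul S) (coef_eY bas) //.
have [E|nE] := eqVneq l j.
  rewrite -E (inj_eq (@shift_injl n l)) eq_sym; case: eqP => _ /=; last exact: frob0.
  by rewrite frob_eY pred_sub_eq // eqxx.
rewrite andbF; case: eqP => _; last exact: frob0.
by rewrite frob_eY pred_sub_eq // (negPf nE).
Qed.

Lemma frob_coef r v l : (l < m)%N -> frob (y ^+ (m.-1 - l) * e v * r) = c v l r.
Proof.
move=> lm; elim/(basis_ind bas): r => [a b IHa IHb|d a IH|w j].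
- by rewrite mulrDr frobD IHa IHb (cb_coefD bas).
- by rewrite mulr_sc frobZ IH (cb_coefZ bas).
rewrite -!mulrA (mulrA (e v)) (cs_orth S) (coef_eY bas) //.
have [E|_] := eqVneq v w; last by rewrite mul0r mulr0 frob0.
by rewrite mulrA (y_e bas) -mulrA -exprD frob_eY addnC pred_sub_eq.
Qed.

Lemma frob_ext r r' : (forall s, frob (s * r) = frob (s * r')) -> r = r'.
Proof.
move=> rr; apply: (cb_coef_inj bas) => v l lm.
by rewrite -!frob_coef.
Qed.

(** The partial map is composed with [frob] and extended to a k-linear functional h; the dual basis
    then produces g with frob(s g(x)) = h(s x) for all s. Nondegeneracy of [frob] makes g linear
    over R and an extension of the given map. A graph is used so that the domain may be any
    submodule of N. *)
Lemma linear_extension (N : lmodType R) (G0 : set (N * R)) :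
  G0 (0, 0) ->
  (forall x z (a : R), G0 x -> G0 z -> G0 (a *: x.1 + z.1, a * x.2 + z.2)) ->
  (forall r, G0 (0, r) -> r = 0) ->
  exists g : {linear N -> R^o}, forall x r, G0 (x, r) -> g x = r.
Proof.
move=> G00 G0D G0f.
have [|h [hD hZ hG]] := @functional_extension k R N
    (fun z => exists2 r, G0 (z.1, r) & z.2 = frob r).
  split=> /= [|[x d] [z d'] a /= [r Gr ->] [r' Gr' ->]|d [r /G0f-> ->]].
  - by exists 0; rewrite ?frob0.
  - exists (sc R a * r + r'); last by rewrite frobD frobZ.
    exact: (G0D (x, r) (z, r')).
  - exact: frob0.
have h0 : h 0 = 0 by rewrite -[X in h X](scale0r 0) -(rmorph0 (sc R)) hZ mul0r.
have h_sum (I : Type) (s : seq I) (F : I -> N) :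
    h (\sum_(i <- s) F i) = \sum_(i <- s) h (F i).
  exact: (big_morph h hD h0).
pose g (x : N) : R :=
  \sum_v \sum_(l < m) sc R (h ((e v * y ^+ l) *: x)) * dual_elt v l.
have gP s x : frob (s * g x) = h (s *: x).
  rewrite {2}(cb_span bas s) scaler_suml h_sum mulr_sumr frob_sum.
  apply: eq_bigr => v _; rewrite scaler_suml h_sum mulr_sumr frob_sum.
  apply: eq_bigr => l _.
  by rewrite mulr_sc frobZ frob_dual // -[in RHS]scalerA hZ mulrC.
have gL : linear (g : N -> R^o).
  move=> a x z; apply: frob_ext => s.
  transitivity (frob (s * (a * g x + g z))); last by [].
  by rewrite mulrDr frobD mulrA !gP scalerDr hD scalerA.
pose mg := GRing.isLinear.Build _ _ _ _ (g : N -> R^o) gL.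
pose G : {linear N -> R^o} := HB.pack (g : N -> R^o) mg.
exists G => x r Gxr; apply: frob_ext => s.
rewrite -[G x]/(g x) gP; apply: hG; exists (s * r) => //=.
by have := G0D _ _ s Gxr G00; rewrite /= !addr0.
Qed.

Lemma cyc_injective : @injective_module R R^o.
Proof.
move=> M N i f i_inj.
have [||r [m' /esym]|g gP] := @linear_extension N
    (fun z => exists m', z = (i m', f m')).
- by exists 0; rewrite !linear0.
- move=> _ _ a [m1 ->] [m2 ->]; exists (a *: m1 + m2).
  by rewrite !linearP.
- case=> im0 <-; have -> : m' = 0 by apply: i_inj; rewrite im0 linear0.
  exact: linear0.
by exists g => m'; apply: gP; exists m'.
Qed.
End Frobenius.

(** * Serial projective modules *)

Section FreeCover.
Variables (R : pzRingType) (P : lmodType R).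

(* monalg.v only scales {malg R[K]} when R is nonzero. *)
Definition free_mod : Type := {malg R[P]}.
HB.instance Definition _ := GRing.Zmodule.on free_mod.
Implicit Types (f g : free_mod).

Definition free_scale (a : R) g : free_mod :=
  \sum_(x <- msupp g) << a * g@_x *g x >>.

Lemma free_scaleE a g x : (free_scale a g)@_x = a * g@_x.
Proof.
rewrite /free_scale [in RHS](monalgE g) [LHS](raddf_sum (mcoeff x)).
rewrite [X in _ * X](raddf_sum (mcoeff x)) mulr_sumr.
by apply: eq_bigr => z _; rewrite /= !mcoeffU mulrnAr.
Qed.

Fact free_scaleA a b g : free_scale a (free_scale b g) = free_scale (a * b) g.
Proof. by apply/malgP => x; rewrite !free_scaleE mulrA. Qed.
Fact free_scale1 : left_id 1 free_scale.
Proof. by move=> g; apply/malgP => x; rewrite free_scaleE mul1r. Qed.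
Fact free_scaleDr : right_distributive free_scale +%R.
Proof.
move=> a f g; apply/malgP => x.
by rewrite free_scaleE [in RHS]mcoeffD !free_scaleE [in LHS]mcoeffD mulrDr.
Qed.
Fact free_scaleDl g : {morph free_scale^~ g : a b / a + b}.
Proof.
move=> a b; apply/malgP => x.
by rewrite free_scaleE [in RHS]mcoeffD !free_scaleE mulrDl.
Qed.
HB.instance Definition _ := GRing.Zmodule_isLmodule.Build R free_mod
  free_scaleA free_scale1 free_scaleDr free_scaleDl.

Definition cover g : P := \sum_(x <- msupp g) g@_x *: x.

Lemma coverw (d : {fset P}) g : (msupp g `<=` d)%fset ->
  cover g = \sum_(x <- d) g@_x *: x.
Proof.
move=> le; rewrite /cover (big_fset_incl _ le) //= => x _ /mcoeff_outdom ->.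
by rewrite scale0r.
Qed.

Fact cover_linear : linear cover.
Proof.
move=> a f g; pose d := (msupp f `|` msupp g `|` msupp (a *: f + g)%R)%fset.
rewrite !(@coverw d).
- rewrite scaler_sumr -big_split; apply: eq_bigr => x _ /=.
  by rewrite [(_ + _)@__]mcoeffD free_scaleE scalerDl scalerA.
- by rewrite /d -fsetUA fsetUCA fsubsetUl.
- by rewrite /d -fsetUA fsubsetUl.
- by rewrite /d fsubsetUr.
Qed.
HB.instance Definition _ := GRing.isLinear.Build R free_mod P *:%R cover cover_linear.

Lemma cover_surj x : exists f, cover f = x.
Proof.
exists (<< x >> : free_mod); rewrite (@coverw [fset x]%fset) ?msuppU_le //.
by rewrite big_seq_fset1 mcoeffUU scale1r.
Qed.

(** The coordinates are those of a section of the free cover on the underlying set of P; finite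
    supports give the finite sums. *)
Lemma projective_dual_basis : projective_module P ->
  exists phi : P -> P -> R, (forall a x z, phi (a *: x) z = a * phi x z) /\
    forall x, exists s : seq P, x = \sum_(z <- s) phi x z *: z.
Proof.
move=> /(_ free_mod P cover idfun cover_surj) [s sP].
exists (fun x z => (s x : free_mod)@_z); split=> [a x z|x].
  by rewrite linearZ; exact: free_scaleE.
by exists (msupp (s x : free_mod)); rewrite -[LHS]sP.
Qed.
End FreeCover.

Section Serial.
Variables (k : fieldType) (n m : nat) (R : salg k) (e : 'I_n.+1 -> R) (y : R).
Variable c : 'I_n.+1 -> nat -> R -> k.
Hypotheses (bas : cyc_basis m 0 e y c) (m_gt0 : (0 < m)%N).
Let S := cb_sys bas.

(** By [frob_coef], the hypothesis kills the coefficients of the trivial paths, and e_v y^l = y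
    e_(v+1) y^(l-1) for l > 0. *)
Lemma top_ann r : y ^+ m.-1 * r = 0 -> exists d, r = y * d.
Proof.
move=> yr; exists (\sum_v \sum_(l < m) sc R (c v l r) * (e (ordS v) * y ^+ l.-1)).
rewrite {1}(cb_span bas r) mulr_sumr; apply: eq_bigr => v _.
rewrite mulr_sumr; apply: eq_bigr => -[[|l] lm] _ /=.
  rewrite -(frob_coef bas) // subn0 (y_e bas) -mulrA yr mulr0.
  by rewrite (frob0 bas) rmorph0 !mul0r mulr0.
by rewrite exprS (mulrA (e v)) (cs_shift S) -mulrA mulr_sc.
Qed.

(** C is coprime to X^m and y^m = 0, so a Bezout relation evaluates to an inverse. *)
Lemma peval_inv (C : {poly k}) : C.[0] != 0 -> exists D, peval y D * peval y C = 1.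
Proof.
move=> C0; have : coprimep C ('X ^+ m).
  apply: coprimep_expr; rewrite -['X]subr0 -polyC0 coprimep_XsubC.
  by rewrite rootE.
move=> /Bezout_eq1_coprimepP [[D E] /= DE]; exists D.
have := congr1 (peval y) DE; rewrite raddfD /= !pevalM pevalXn (ym0 bas) mulr0.
by rewrite addr0 peval1.
Qed.

Lemma right_ideal_poly r v : exists C, r * e v = peval y C * e v.
Proof.
elim/(basis_ind bas): r => [a b [C Ca] [D Db]|d a [C Ca]|w l].
- by exists (C + D); rewrite raddfD /= !mulrDl Ca Db.
- by exists (d *: C); rewrite pevalZ -!mulrA Ca.
have [E|E] := eqVneq (shift l w) v.
  exists 'X^l; rewrite pevalXn (sys_shift S) E -mulrA (cs_orth S) eqxx.
  by [].
exists 0; rewrite raddf0 mul0r (sys_shift S) -mulrA (cs_orth S) (negPf E).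
by rewrite mulr0.
Qed.

(** An element of R e_v is C(y) e_v for a polynomial C = D X^i with D(0) != 0 (unless C = 0), and
    D(y) is left invertible. *)
Lemma right_ideal_gen r v : r * e v = 0 \/ exists i a b,
  [/\ (i < m)%N, r * e v = a * (y ^+ i * e v) & y ^+ i * e v = b * (r * e v)].
Proof.
have [C ->] := right_ideal_poly r v.
have [->|C0] := eqVneq C 0; first by left; rewrite raddf0 mul0r.
have [i [D DC CE]] := multiplicity_XsubC C 0.
rewrite C0 /= in DC; rewrite polyC0 subr0 in CE.
have pC : peval y C = peval y D * y ^+ i by rewrite CE pevalM pevalXn.
have [mi|im] := leqP m i; first by left; rewrite pC (yge0 bas mi) mulr0 mul0r.
have [|E ED] := @peval_inv D; first by rewrite -rootE.
right; exists i, (peval y D), (peval y E); split=> //; first by rewrite pC mulrA.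
by rewrite pC !mulrA ED mul1r.
Qed.

Lemma cyc_left_serial : left_serial R.
Proof.
move=> P Pproj [[x0 x0_neq] Pind].
(* Otherwise all dual-basis coordinates lie in yR by [top_ann], so P = yP, and iterating gives P =
   y^m P = 0. *)
have [u yu] : exists u : P, y ^+ m.-1 *: u <> 0.
  apply: contrapT => none; have top (u : P) : y ^+ m.-1 *: u = 0.
    by apply: contrapT => yu; apply: none; exists u.
  have [phi [phiZ phiP]] := projective_dual_basis Pproj.
  have div (u : P) : exists u', u = y *: u'.
    have [s uE] := phiP u.
    have /choice[d dE] (z : P) : exists d, phi u z = y * d.
      apply: top_ann; rewrite -phiZ top -[X in phi X _](scale0r (0 : P)) phiZ.
      by rewrite mul0r.
    exists (\sum_(z <- s) d z *: z); rewrite {1}uE scaler_sumr.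
    by apply: eq_bigr => z _; rewrite scalerA dE.
  have divn i (u' : P) : exists u'', u' = y ^+ i *: u''.
    elim: i u' => [|i IH] u'; first by exists u'; rewrite scale1r.
    have [u1 ->] := div u'; have [u2 ->] := IH u1.
    by exists u2; rewrite exprS scalerA.
  apply: x0_neq; have [u' ->] := divn m x0.
  by rewrite (ym0 bas) scale0r.
have [v yv] : exists v, y ^+ m.-1 *: (e v *: u) <> 0.
  apply: contrapT => none; apply: yu.
  rewrite -[u]scale1r -(cb_sum bas) scaler_suml scaler_sumr big1 // => v _.
  by apply: contrapT => yv; apply: none; exists v.
pose w := e v *: u.
have ew : e v *: w = w by rewrite scalerA (cs_orth S) eqxx.
have reE r : (r * e v) *: w = r *: w by rewrite -scalerA ew.
(* Thus Rw is a copy of R e_v. If r e_v were nonzero, some y^i e_v with i < m would be a multiple of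
   it, so r w = 0 would force y^(m-1) w = 0. *)
have inj r : r *: w = 0 -> r * e v = 0.
  move=> rw; case: (right_ideal_gen r v) => // -[i [a [b [im _ yi]]]].
  case: yv; have im1 : (i <= m.-1)%N by rewrite -ltnS prednK.
  rewrite -/w -ew scalerA -(subnK im1) exprD -mulrA yi -!scalerA ew rw !scaler0.
  by [].
have [||r [s [/esym /inj]]|g gP] := @linear_extension k n m R e y c bas m_gt0 P
    (fun z => exists r, z = (r *: w, r * e v)).
- by exists 0; rewrite scale0r mul0r.
- move=> _ _ a [r ->] [s ->]; exists (a * r + s) => /=.
  by rewrite scalerDl scalerA mulrDl mulrA.
- by move=> s0 ->.
have gw r : g (r *: w) = r * e v by apply: gP; exists r.
pose U : set P := fun x => exists r, x = r *: w.
(* V is a complement of U = Rw: the map x -> g(x) w retracts P onto U, and V consists of its kernel.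
   Indecomposability then leaves only P = Rw. *)
pose V : set P := fun x => (g x : R) * e v = 0.
have Usub : is_submodule U.
  split=> [|a _ _ [r ->] [s ->]]; first by exists 0; rewrite scale0r.
  by exists (a * r + s); rewrite scalerDl scalerA.
have Vsub : is_submodule V.
  split=> [|a x z Vx Vz]; first by rewrite /V linear0 mul0r.
  by rewrite /V linearP mulrDl -[_ *: _]/(_ * _) -mulrA Vx Vz mulr0 addr0.
have UV (x : P) : exists x1 x2, [/\ U x1, V x2 & x = x1 + x2].
  exists ((g x : R) *: w), (x - (g x : R) *: w); split; first by exists (g x).
    by rewrite /V linearB /= gw mulrBl -mulrA (cs_orth S) eqxx subrr.
  by rewrite addrC subrK.
have U0V : setI U V = [set 0]%classic.
  apply/seteqP; split=> [_ [[r ->]]|_ ->].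
    by rewrite /V gw -mulrA (cs_orth S) eqxx -reE => -> /=; rewrite scale0r.
  by split; [case: Usub|case: Vsub].
have Pw (x : P) : exists r, x = r *: w.
  have [U0|V0] := Pind U V Usub Vsub UV U0V.
    case: yv; have : U w by exists 1; rewrite scale1r.
    by rewrite U0 /= => w0; rewrite -/w w0 scaler0.
  have [x1 [x2 [Ux1 Vx2 ->]]] := UV x.
  by move: Vx2; rewrite V0 /= => ->; rewrite addr0.
have gen (x : P) : x = 0 \/ exists i a b, x = a *: (y ^+ i *: w) /\ y ^+ i *: w = b *: x.
  have [r ->] := Pw x; case: (right_ideal_gen r v) => [rv|[i [a [b [_ ra yb]]]]].
    by left; rewrite -reE rv scale0r.
  right; exists i, a, b; rewrite -[r *: w]reE -[y ^+ i *: w]reE.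
  by rewrite {1}ra yb !scalerA.
have subZ (X : set P) : is_submodule X -> forall a x, X x -> X (a *: x).
  by move=> [X0 XD] a x Xx; rewrite -[a *: x]addr0; exact: XD.
move=> X Z Xsub Zsub; have [XZ|nXZ] := pselect (subset X Z); first by left.
right=> z Zz; apply: contrapT => nXz; apply: nXZ => x Xx.
case: (gen x) => [->|[i [a [b [xE yx]]]]]; first by case: Zsub.
case: (gen z) => [z0|[j [a' [b' [zE yz]]]]].
  by case: nXz; rewrite z0; case: Xsub.
have [ij|ji] := leqP i j.
  case: nXz; rewrite zE -(subnK ij) exprD -scalerA yx.
  by do 3 apply: (subZ _ Xsub).
rewrite xE -(subnK (ltnW ji)) exprD -scalerA yz.
by do 3 apply: (subZ _ Zsub).
Qed.
End Serial.

(** * Scalars, dimension and assembly of the theorem *)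

Section QuotientScaling.
Variables (k : fieldType).

Lemma pres_scale (rels : seq (freeAlg k)) c (u : pres rels) :
  sc (pres rels) c * u =
  c *: (u : {quotAlg (freeAlg k) / ideal_gen [set` rels]}).
Proof. exact: quot_sc_scale. Qed.

Lemma shift_neq n l (v : 'I_n.+1) : (0 < l < n.+1)%N -> shift l v != v.
Proof.
move=> /andP[l0 ln]; apply/eqP => E.
by move: l0; rewrite (@shift_inj _ l 0 v ln).
Qed.

Lemma basis_coordinates n m kap (T : salg k) (e : 'I_n.+1 -> T) y cf :
  cyc_basis m kap e y cf ->
  exists2 f : T -> 'rV[k]_(n.+1 * m),
    forall d a b, f (sc T d * a + b) = d *: f a + f b & bijective f.
Proof.
move=> bas; exists (fun a => mxvec (\matrix_(v, l) cf v l a)).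
  move=> d a b; rewrite -linearP /=; congr mxvec.
  by apply/matrixP => v l; rewrite !mxE (cb_coefD bas) (cb_coefZ bas).
exists (fun u => \sum_v \sum_(l < m) sc T (vec_mx u v l) * (e v * y ^+ l)) => [a|u].
  rewrite [RHS](cb_span bas); apply: eq_bigr => v _; apply: eq_bigr => l _.
  by rewrite mxvecK mxE.
apply: (can_inj (@vec_mxK _ _ _)); rewrite mxvecK; apply/matrixP => v l.
rewrite mxE (cb_coef_sum bas) (bigD1 v) //= (cb_coef_sum bas) (bigD1 l) //=.
rewrite (cb_coefZ bas) (cb_dual bas) // !eqxx mulr1 !big1 ?addr0 // => [w nw|j nj].
  rewrite (cb_coef_sum bas) big1 // => j _.
  by rewrite (cb_coefZ bas) (cb_dual bas) // eq_sym (negPf nw) mulr0.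
rewrite (cb_coefZ bas) (cb_dual bas) // [l == j :> nat]eq_sym.
by rewrite [j == l :> nat](negPf nj) andbF mulr0.
Qed.

Lemma trunc_vector n m : (0 < m)%N ->
  inhabited (Vector.axiom (n.+1 * m) (cyclic_trunc k n m)).
Proof.
move=> m_gt0; have [f fL fB] := basis_coordinates (trunc_basis k n m_gt0).
constructor; exists f => // d a b; rewrite -fL; congr (f (_ + _)).
exact/esym/trunc_scale.
Qed.
End QuotientScaling.

Lemma trunc_selfinjective (k : fieldType) n m : (0 < m)%N ->
  selfinjective (cyclic_trunc k n m).
Proof.
move=> m_gt0; have bas := trunc_basis k n m_gt0; split.
  exact: (cyc_injective bas m_gt0).
exact: (cyc_injective (conv_basis bas m_gt0) m_gt0).
Qed.

Lemma trunc_nakayama (k : fieldType) n m : (0 < m)%N ->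
  nakayama (cyclic_trunc k n m).
Proof.
move=> m_gt0; have bas := trunc_basis k n m_gt0; split.
  exact: (cyc_left_serial bas m_gt0).
exact: (cyc_left_serial (conv_basis bas m_gt0) m_gt0).
Qed.

Theorem proposition5p1 (p : nat) (k : fieldType)
    (hp : prime p) (hk : p \in [pchar k]) :
  [/\ algB2 k p ≃alg cyclic_trunc k (p ^ 2).-1 p /\
        ~ symmetric_alg (L := algB2 k p) *%R,
      algC12 k p ≃alg cyclic_trunc k p.-1 (p ^ 2),
      [/\ algC13 k p ≃alg {ffun 'I_p -> cyclic_trunc k p.-1 p},
          selfinjective (cyclic_trunc k p.-1 p),
          nakayama (cyclic_trunc k p.-1 p)
        & inhabited (Vector.axiom (p ^ 2) (cyclic_trunc k p.-1 p))]
    & algC14 k p ≃alg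
        (cyclic_trunc k p.-1 p * {ffun 'I_p.-1 -> 'M[k]_p})%type].
Proof.
case: p hp hk => // n hp hk; have p_gt1 := prime_gt1 hp.
have hq : (n.+1 ^ 2).-1.+1 = (n.+1 ^ 2)%N by rewrite prednK // expn_gt0.
have basB := trunc_basis k (n.+1 ^ 2).-1 (ltn0Sn n).
have basN := trunc_basis k n (ltn0Sn n).
split; [|
  |split; [|exact: trunc_selfinjective|exact: trunc_nakayama|exact: trunc_vector]|].
- have [F [Fsc Fbij]] := B2_iso hk hq (pres_presented (@relsB2P k n.+1)) basB.
  have Fscale c (u : algB2 k n.+1) : F (c *: u) = sc (trunc_salg _ _ _) c * F u.
    by rewrite -Fsc -rmorphM; congr (F _); exact/esym/pres_scale.
  split.
    exists F; split=> // c u.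
    by rewrite Fscale; exact: trunc_scale.
  move=> /(symmetric_trace (A := trunc_salg _ _ _) Fbij).
  move=> [|||lam [lamD lamZ lamC lam_nd]].
  + exact: rmorphD.
  + exact: Fscale.
  + exact: rmorphM.
  have [|l l0 /lam_nd l00] := trace_form_degenerate basB (ltn0Sn n) _ lamD lamZ lamC.
    (* A path of length p - 1 is not closed on a cycle of p^2 vertices, because 0 < p - 1 < p^2. *)
    move=> v; apply: shift_neq; rewrite -ltnS p_gt1 hq /=.
    by rewrite -mulnn mulnS addSn ltnS leq_addr.
  by rewrite l00 eqxx in l0.
- have m_gt0 : (0 < n.+1 ^ 2)%N by rewrite expn_gt0.
  have [F [Fsc Fbij]] := C12_iso hk (pres_presented (@relsC12P k n.+1))
    (trunc_basis k n m_gt0).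
  exists F; split=> // c u.
  transitivity (F (sc (pres _) c * u)); first by congr (F _); exact/esym/pres_scale.
  by rewrite rmorphM Fsc; exact: trunc_scale.
- have [F [Fsc Fbij]] := C13_iso hk (pres_presented (@relsC13P k n.+1)) basN.
  exists F; split=> // c u; apply/ffunP => t; rewrite ffunE.
  transitivity (F (sc (pres _) c * u) t).
    by congr (F _ t); exact/esym/pres_scale.
  by rewrite Fsc; exact: trunc_scale.
have [F [F1 F2 Fbij]] := C14_iso hk (pres_presented (@relsC14P k n.+1)) basN
  (mat_basis k n).
exists F; split=> // c u.
have -> : F (c *: u) = F (sc (pres _) c * u).
  by congr (F _); exact/esym/pres_scale.
transitivity (c *: (F u).1, c *: (F u).2); last by [].
rewrite [LHS]surjective_pairing; congr (_, _).
  by rewrite F1; exact: trunc_scale.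
apply/ffunP => t; rewrite F2 ffunE.
exact: mul_scalar_mx.
Qed.
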